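(* Let $p\geq 3$ be a prime and let $U=\langle x_r(t): r\in\Phi^+, t\in\mathbb{Z}/p\mathbb{Z}\rangle$ be a unipotent subgroup of a classical Chevalley group over $\mathbb{Z}/p\mathbb{Z}$ with Lie rank $d$. Let $m=\lceil d/2\rceil$ if the type is $A$, $B$ or $C$, and $m=\lfloor d/2\rfloor$ if the type is $D$. Then $U/U'$ has an $\mathrm{Aut}(U)$-invariant series of length $m$. There is at most one factor with dimension $1$, and if $U$ is of type $D$, then there is a factor of dimension $3$. All other factors have dimension $2$.
   Context: $\Phi$ is the root system of classical type $A_d,B_d,C_d$ or $D_d$ (with $d\ge4$ in type $D$), $\Phi^+$ its positive roots, and $x_r(t)=\exp(t\,\mathrm{ad}\,e_r)$ for a Chevalley basis $\{h_r\}\cup\{e_s\}$ of the corresponding Lie algebra. $U'=[U,U]$. The quotient $U/U'$ is a vector space over $\mathbb{Z}/p\mathbb{Z}$; the series consists of subspaces from $U/U'$ down to $0$, its length is the number of its (nonzero) factors, and dimension means dimension over $\mathbb{Z}/p\mathbb{Z}$. *)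

(* Defs.v *)
From HB Require Import structures.
From mathcomp Require Import all_boot all_order all_algebra.
From mathcomp Require Import all_fingroup all_solvable.

Set Implicit Arguments.
Unset Strict Implicit.
Unset Printing Implicit Defensive.

Import GRing.Theory Num.Theory.

Inductive classical_type := TypeA | TypeB | TypeC | TypeD.

Section RootSystem.

Local Open Scope ring_scope.

(* Standard coordinates: the roots of type A_d lie in Z^(d+1), those of types
   B_d, C_d and D_d in Z^d.  Coordinates are numbered from 0. *)
Definition ambient_dim (T : classical_type) (d : nat) : nat :=
  if T is TypeA then d.+1 else d.

Definition eps (n i : nat) : 'rV[int]_n := \row_(j < n) ((j : nat) == i)%:R.

Definition root_diffs (n : nat) : seq 'rV[int]_n :=
  [seq eps n i - eps n j | i <- iota 0 n, j <- index_iota i.+1 n].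

Definition root_sums (n : nat) : seq 'rV[int]_n :=
  [seq eps n i + eps n j | i <- iota 0 n, j <- index_iota i.+1 n].

Definition pos_roots (T : classical_type) (d : nat) :
    seq 'rV[int]_(ambient_dim T d) :=
  match T with
  | TypeA => root_diffs d.+1
  | TypeB => root_diffs d ++ root_sums d ++ [seq eps d i | i <- iota 0 d]
  | TypeC => root_diffs d ++ root_sums d ++ [seq eps d i *+ 2 | i <- iota 0 d]
  | TypeD => root_diffs d ++ root_sums d
  end.

Definition roots (T : classical_type) (d : nat) :
    seq 'rV[int]_(ambient_dim T d) :=
  pos_roots T d ++ [seq - r | r <- pos_roots T d].

Definition simple_roots (T : classical_type) (d : nat) :
    seq 'rV[int]_(ambient_dim T d) :=
  match T with
  | TypeA => [seq eps d.+1 i - eps d.+1 i.+1 | i <- iota 0 d]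
  | TypeB => rcons [seq eps d i - eps d i.+1 | i <- iota 0 d.-1] (eps d d.-1)
  | TypeC => rcons [seq eps d i - eps d i.+1 | i <- iota 0 d.-1]
                   (eps d d.-1 *+ 2)
  | TypeD => rcons [seq eps d i - eps d i.+1 | i <- iota 0 d.-1]
                   (eps d d.-2 + eps d d.-1)
  end.

Definition dot (n : nat) (r s : 'rV[int]_n) : int :=
  \sum_(i < n) r 0 i * s 0 i.

(* A_rs = 2 (r, s) / (r, r); the division is exact when r and s are roots. *)
Definition cartan_int (n : nat) (r s : 'rV[int]_n) : int :=
  ((2 * dot r s) %/ dot r r)%Z.

(* The greatest k such that s - k r is a root, for linearly independent roots
   r and s.  The roots s - k r are distinct, so k is at most the number of
   roots. *)
Definition chain_down (T : classical_type) (d : nat)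
    (r s : 'rV[int]_(ambient_dim T d)) : nat :=
  \max_(k < (size (roots T d)).+1 | s - r *+ k \in roots T d) k.

End RootSystem.

Section ChevalleyBasis.

Local Open Scope ring_scope.

Definition lie_bracket (K : fieldType) (L : vectType K)
    (br : L -> L -> L) : Prop :=
  [/\ forall x, linear (br x),
      forall y, linear (br^~ y),
      forall x, br x x = 0
    & forall x y z, br x (br y z) + br y (br z x) + br z (br x y) = 0].

(* The family h_r (r simple) followed by the family e_r (r a root). *)
Definition chevalley_tuple (T : classical_type) (d : nat) (V : Type)
    (h e : 'rV[int]_(ambient_dim T d) -> V) :
    (size (simple_roots T d) + size (roots T d)).-tuple V :=
  cat_tuple (map_tuple h (in_tuple (simple_roots T d)))
            (map_tuple e (in_tuple (roots T d))).

(* Only the values of h and e at roots matter.  The co-root h_r is given for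
   every root r, but only the simple ones enter the basis. *)
Definition chevalley_basis (K : fieldType) (L : vectType K) (br : L -> L -> L)
    (T : classical_type) (d : nat)
    (h e : 'rV[int]_(ambient_dim T d) -> L) : Prop :=
  basis_of fullv (chevalley_tuple h e) /\
  {in roots T d &, forall r s,
    [/\ br (h r) (h s) = 0,
        br (h r) (e s) = e s *~ cartan_int r s,
        br (e r) (e (- r)) = h r,
        r + s != 0 -> r + s \notin roots T d -> br (e r) (e s) = 0
      & r + s \in roots T d ->
          br (e r) (e s) = e (r + s) *+ (chain_down r s).+1 \/
          br (e r) (e s) = - (e (r + s) *+ (chain_down r s).+1)]}.

(* Matrix of ad x in the basis b, acting on column vectors. *)
Definition ad_mx (K : fieldType) (L : vectType K) (br : L -> L -> L)
    (N : nat) (b : N.-tuple L) (x : L) : 'M[K]_N :=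
  \matrix_(i, j) coord b i (br x (tnth b j)).

(* The entries of A^k / k! are integers when A is the matrix of ad e_r in a
   Chevalley basis, so that exp(t A) makes sense over Z/pZ; Num.floor turns
   these entries into elements of int.  As A is nilpotent of size N, all the
   nonzero terms of the exponential series are present. *)
Definition exp_mod (K : archiNumFieldType) (p N : nat) (A : 'M[K]_N)
    (t : 'F_p) : 'M['F_p]_N :=
  \sum_(k < N.+1)
    t ^+ k *: map_mx (fun z : K => (Num.floor z)%:~R) ((k`!%:R)^-1 *: A ^+ k).

Definition root_mx (K : archiNumFieldType) (L : vectType K) (br : L -> L -> L)
    (T : classical_type) (d : nat) (h e : 'rV[int]_(ambient_dim T d) -> L)
    (p : nat) (r : 'rV[int]_(ambient_dim T d)) (t : 'F_p) :
    'M['F_p]_(size (simple_roots T d) + size (roots T d)) :=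
  exp_mod (ad_mx br (chevalley_tuple h e) (e r)) t.

Local Open Scope group_scope.

(* The matrices of {'GL_N[F]} have size N.-1.+1, which is N here; conform_mx is
   the cast between the two.  Each x_r(t), being the exponential of a nilpotent
   matrix, is invertible, hence is one of the generators below. *)
Definition unipotent_subgroup (K : archiNumFieldType) (L : vectType K)
    (br : L -> L -> L) (T : classical_type) (d : nat)
    (h e : 'rV[int]_(ambient_dim T d) -> L) (p : nat) :
    {group {'GL_(size (simple_roots T d) + size (roots T d))['F_p]}} :=
  <<[set g | has (fun r => [exists t : 'F_p,
                    GLval g == conform_mx 0%R (root_mx br h e r t)])
                 (pos_roots T d)]>>%G.

End ChevalleyBasis.

Section Series.

Local Open Scope group_scope.

Variable gT : finGroupType.

(* W is stable under the automorphisms of U / U' induced by those of U. *)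
Definition Aut_invariant (U : {group gT})
    (W : {group coset_of [~: U, U]}) : Prop :=
  forall f x, f \in Aut U -> x \in U ->
    coset [~: U, U] x \in W -> coset [~: U, U] (f x) \in W.

(* Dimension over Z/pZ of the factor V / W, for V elementary abelian. *)
Definition factor_dim (p : nat) (V W : {group gT}) : nat := logn p #|V / W|.

End Series.

Definition series_length (T : classical_type) (d : nat) : nat :=
  if T is TypeD then d./2 else uphalf d.

(* Main.v *)
From mathcomp Require Import all_boot all_order all_algebra.
From mathcomp Require Import all_fingroup all_solvable.
From mathcomp Require Import zify ring ssrAC.
Require Import Defs.

Set Implicit Arguments.
Unset Strict Implicit.
Unset Printing Implicit Defensive.

Import GRing.Theory Num.Theory.

(** The prime is odd and no root string has more than three elements.  So the
    operator [ad e_r] has cube 0, half its square is integral, and [x_r(t)] is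
    the matrix [1 + t A + t^2/2 A^2] over the prime field, where [A] is the
    reduction of the integral matrix of [ad e_r] ([int_ad_cube],
    [int_ad_sqr], [root_mxE]).  The identities that hold along a root string
    then give Chevalley's commutator relations: if [r + s] is a root,
    [[x_r(t), x_s(u)]] is [x_(r+s)(c t u)], with [c] nonzero modulo [p], up to
    root elements of greater height ([unipotent_mx_string],
    [unipotent_elt_comm]).

    Let [G_k] be generated by the root subgroups of height at least [k].  By
    these relations [G_k] is the [k]-th term of the lower central series of
    [U] ([root_filtrationE]), hence is characteristic.  On [G_(ht s)] a well
    chosen entry of a matrix, in the row of [e_s] and in the column of a simple
    coroot, is additive and detects the root [s] ([int_ad_detect]).  For simple
    roots these coordinates show that the images of the [x_(al i)(1)] are a
    basis of [U/U'], and for the other roots that commutators do not vanish.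

    An element [g] of [U] acts trivially on [G_k/G_(k+2)], that is,
    [[g, G_k]] lies in [G_(k+2)], if and only if the coordinate of [g] at
    [al i] is 0 for all the [i] such that [al i] can be subtracted from a
    root of height [k + 1] ([centralizes_modP]).  The left side is invariant
    under automorphisms.  So for each set of layers [k], the simple roots that
    act on none of these layers span an invariant subspace of [U/U'].

    It remains to know on which layers a simple root acts.  The greatest height
    of a root from which [al i] can be subtracted, [last_height], is, with the
    numbering from 0, [max (i + 1) (d - i)] in type A and [2 d - 1 - i] in type
    C; in type B it is [2 d - 2] for [i = 0] and [2 d - i] otherwise; in type D
    it is [2 d - 4] for [i = 0], [d] for [i = d - 1], and [2 d - 2 - i]
    otherwise.  The sets of simple roots for which this height is at most a
    given bound form the series: coarsely enough thresholds remove two simple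
    roots at each step, except for at most one step where a single one goes
    and, in type D, one step with three ([flag_card_steps]).  In type B
    these sets have [d], [d - 1], [d - 3], [d - 4], ... elements, so that for
    even [d > 2] they would need two steps of size one; the first step uses instead
    the single layer [2 d - 3], on which only the simple roots number 0 and 2
    act ([definable_B02]). *)

(** * Root systems in coordinates *)

Section Coordinates.

Local Open Scope ring_scope.

Variable n : nat.
Implicit Types r s u : 'rV[int]_n.

Lemma dotC r s : dot r s = dot s r.
Proof. by apply: eq_bigr => i _; rewrite mulrC. Qed.

Lemma dotDl r s u : dot (r + s) u = dot r u + dot s u.
Proof. by rewrite -big_split; apply: eq_bigr => i _; rewrite mxE mulrDl. Qed.

Lemma dotNl r u : dot (- r) u = - dot r u.
Proof. by rewrite -sumrN; apply: eq_bigr => i _; rewrite mxE mulNr. Qed.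

Lemma dotMnl r u k : dot (r *+ k) u = dot r u * k%:Z.
Proof.
elim: k => [|k IHk].
  rewrite mulr0n mulr0 /dot big1 // => i _; by rewrite mxE mul0r.
by rewrite mulrS dotDl IHk -add1n PoszD mulrDr mulr1.
Qed.

Lemma dotDr r s u : dot u (r + s) = dot u r + dot u s.
Proof. by rewrite dotC dotDl !(dotC u). Qed.

Lemma dotNr r u : dot u (- r) = - dot u r.
Proof. by rewrite dotC dotNl dotC. Qed.

Lemma dotMnr r u k : dot u (r *+ k) = dot u r * k%:Z.
Proof. by rewrite dotC dotMnl dotC. Qed.

Definition dotE := (dotDl, dotDr, dotNl, dotNr, dotMnl, dotMnr).

Lemma dot_eps i j : (i < n)%N -> dot (eps n i) (eps n j) = (i == j).
Proof.
move=> lt_in; rewrite /dot (bigD1 (Ordinal lt_in)) //= big1 => [|k].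
  by rewrite !mxE eqxx mul1r addr0 natz.
by rewrite -val_eqE /= !mxE => /negPf->; rewrite mul0r.
Qed.

Lemma root_diffsP r :
  reflect (exists i j, [/\ (i < j)%N, (j < n)%N & r = eps n i - eps n j])
          (r \in root_diffs n).
Proof.
apply: (iffP allpairsPdep) => [[i [j []]]|[i [j [lt_ij lt_jn ->]]]].
  rewrite mem_iota mem_index_iota => _ /andP[lt_ij lt_jn] ->.
  by exists i, j.
exists i, j; rewrite mem_iota mem_index_iota lt_ij lt_jn; split=> //.
by rewrite (ltn_trans lt_ij).
Qed.

Lemma root_sumsP r :
  reflect (exists i j, [/\ (i < j)%N, (j < n)%N & r = eps n i + eps n j])
          (r \in root_sums n).
Proof.
apply: (iffP allpairsPdep) => [[i [j []]]|[i [j [lt_ij lt_jn ->]]]].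
  rewrite mem_iota mem_index_iota => _ /andP[lt_ij lt_jn] ->.
  by exists i, j.
exists i, j; rewrite mem_iota mem_index_iota lt_ij lt_jn; split=> //.
by rewrite (ltn_trans lt_ij).
Qed.

End Coordinates.

(** Coordinatewise, an equality between combinations of the vectors [eps n i]
    is linear arithmetic on the truth values [i == j]. *)
Ltac vector_eq := apply/rowP=> ?; rewrite ?mulr2n !mxE ?natz; lia.

Section ClassicalRoots.

Local Open Scope ring_scope.

Variable d : nat.
Local Notation dim T := (ambient_dim T d).

Variant pos_root_spec T (r : 'rV[int]_(dim T)) : Prop :=
| PosDiff i j of (i < j)%N & (j < dim T)%N & r = eps (dim T) i - eps (dim T) j
| PosSum i j of T <> TypeA & (i < j)%N & (j < dim T)%N
  & r = eps (dim T) i + eps (dim T) j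
| PosShort i of T = TypeB & (i < dim T)%N & r = eps (dim T) i
| PosLong i of T = TypeC & (i < dim T)%N & r = eps (dim T) i *+ 2.

Lemma pos_rootP T (r : 'rV[int]_(dim T)) :
  reflect (pos_root_spec r) (r \in pos_roots T d).
Proof.
have diffP (m : nat) (u : 'rV[int]_m) := root_diffsP u.
have sumP (m : nat) (u : 'rV[int]_m) := root_sumsP u.
case: T r => r; rewrite /pos_roots; apply: (iffP idP).
- by move/(diffP d.+1)=> [i [j [? ? ->]]]; apply: (@PosDiff TypeA _ i j).
- by case=> // i j ? ? ->; apply/(diffP d.+1); exists i, j.
- rewrite !mem_cat => /or3P[/(diffP d)|/(sumP d)|/mapP].
  + by case=> i [j [? ? ->]]; apply: (@PosDiff TypeB _ i j).
  + by case=> i [j [? ? ->]]; apply: (@PosSum TypeB _ i j).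
  + by case=> i; rewrite mem_iota => ? ->; apply: (@PosShort TypeB _ i).
- case=> // [i j ? ? ->|i j _ ? ? ->|i _ ? ->]; rewrite !mem_cat; apply/or3P.
  + by apply/Or31/(diffP d); exists i, j.
  + by apply/Or32/(sumP d); exists i, j.
  + by apply/Or33/mapP; exists i; rewrite ?mem_iota.
- rewrite !mem_cat => /or3P[/(diffP d)|/(sumP d)|/mapP].
  + by case=> i [j [? ? ->]]; apply: (@PosDiff TypeC _ i j).
  + by case=> i [j [? ? ->]]; apply: (@PosSum TypeC _ i j).
  + by case=> i; rewrite mem_iota => ? ->; apply: (@PosLong TypeC _ i).
- case=> // [i j ? ? ->|i j _ ? ? ->|i _ ? ->]; rewrite !mem_cat; apply/or3P.
  + by apply/Or31/(diffP d); exists i, j.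
  + by apply/Or32/(sumP d); exists i, j.
  + by apply/Or33/mapP; exists i; rewrite ?mem_iota.
- rewrite !mem_cat => /orP[/(diffP d)|/(sumP d)].
  + by case=> i [j [? ? ->]]; apply: (@PosDiff TypeD _ i j).
  + by case=> i [j [? ? ->]]; apply: (@PosSum TypeD _ i j).
- case=> // [i j ? ? ->|i j _ ? ? ->]; rewrite !mem_cat; apply/orP.
  + by left; apply/(diffP d); exists i, j.
  + by right; apply/(sumP d); exists i, j.
Qed.

Definition simple_root T (i : nat) : 'rV[int]_(dim T) :=
  match T return 'rV[int]_(ambient_dim T d) with
  | TypeA => eps d.+1 i - eps d.+1 i.+1
  | TypeB => if i.+1 == d then eps d i else eps d i - eps d i.+1
  | TypeC => if i.+1 == d then eps d i *+ 2 else eps d i - eps d i.+1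
  | TypeD => if i.+1 == d then eps d i.-1 + eps d i else eps d i - eps d i.+1
  end.

Lemma simple_rootsE T :
  (0 < d)%N -> simple_roots T d = [seq simple_root T i | i <- iota 0 d].
Proof.
rewrite /simple_roots /simple_root;
  have iotaS e : iota 0 e.+1 = rcons (iota 0 e) e by rewrite -addn1 iotaD cats1.
case: d T => // e [] // _.
all: rewrite [in RHS]iotaS map_rcons /= eqxx; congr rcons.
all: apply/eq_in_map => i; rewrite mem_iota => /andP[_ lt_ie].
all: by rewrite eqSS ltn_eqF.
Qed.

(** Twice the height: the doubling makes the weights integral in type C. *)
Definition height_weight T (j : nat) : int :=
  match T with
  | TypeA | TypeB => 2 * (d%:Z - j%:Z)
  | TypeC => 2 * (d%:Z - j%:Z) - 1
  | TypeD => 2 * (d%:Z - j%:Z) - 2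
  end.

Definition height2 T (r : 'rV[int]_(dim T)) : int :=
  \sum_(j < dim T) height_weight T j * r 0 j.

Definition height T (r : 'rV[int]_(dim T)) : nat := `|height2 r|./2.

Lemma height2D T (r s : 'rV[int]_(dim T)) :
  height2 (r + s) = height2 r + height2 s.
Proof. by rewrite -big_split; apply: eq_bigr => i _; rewrite mxE mulrDr. Qed.

Lemma height2N T (r : 'rV[int]_(dim T)) : height2 (- r) = - height2 r.
Proof. by rewrite -sumrN; apply: eq_bigr => i _; rewrite mxE mulrN. Qed.

Lemma height2_eps T i :
  (i < dim T)%N -> height2 (eps (dim T) i) = height_weight T i.
Proof.
move=> lt_in; rewrite /height2 (bigD1 (Ordinal lt_in)) //= big1 => [|k].
  by rewrite !mxE eqxx mulr1 addr0.
by rewrite -val_eqE /= !mxE => /negPf->; rewrite mulr0.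
Qed.

Definition heightE := (height2D, height2N, mulr2n).

(** The least squared length of a root: the squared lengths lie between this
    number and its double, and root strings depend on nothing else. *)
Definition short_norm T : int := if T is TypeB then 1 else 2.

Lemma short_norm_gt0 T : 0 < short_norm T.
Proof. by case: T. Qed.

Lemma pos_root_norm T (r : 'rV[int]_(dim T)) :
  r \in pos_roots T d -> short_norm T <= dot r r <= short_norm T *+ 2.
Proof.
have: 1 <= short_norm T <= 2 by case: T {r}.
have: T = TypeB -> short_norm T = 1 by move->.
have: T = TypeC -> short_norm T = 2 by move->.
move: (short_norm T) => m mC mB m12.
case/pos_rootP=> [i j|i j _|i /mB->|i /mC->].
- by move=> ? ? ->; rewrite !dotE !dot_eps //; lia.
- by move=> ? ? ->; rewrite !dotE !dot_eps //; lia.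
- by move=> ? ->; rewrite dot_eps // eqxx.
- by move=> ? ->; rewrite !dotE dot_eps // eqxx.
Qed.

Lemma rootsP T (r : 'rV[int]_(dim T)) :
  reflect (r \in pos_roots T d \/ - r \in pos_roots T d) (r \in roots T d).
Proof.
by rewrite mem_cat -{4}[r]opprK (mem_map oppr_inj); apply: orP.
Qed.

Lemma root_norm T (r : 'rV[int]_(dim T)) :
  r \in roots T d -> short_norm T <= dot r r <= short_norm T *+ 2.
Proof.
case/rootsP=> /pos_root_norm //; by rewrite !dotE opprK.
Qed.

Lemma rootN T (r : 'rV[int]_(dim T)) : (- r \in roots T d) = (r \in roots T d).
Proof.
by apply/rootsP/rootsP; rewrite opprK => -[]; [right|left|right|left].
Qed.

(** The Cartan integers are defined by a division, which is exact. *)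
Lemma root_dvd T (r s : 'rV[int]_(dim T)) :
  r \in roots T d -> s \in roots T d -> (dot r r %| 2 * dot r s)%Z.
Proof.
have pos u v : u \in pos_roots T d -> (dot u u %| 2 * dot u v)%Z.
  case/pos_rootP=> [i j|i j _|i _|i _].
  - move=> ? ? ->; set w := _ - _; suff -> : dot w w = 2 by rewrite dvdz_mulr.
    by rewrite !dotE !dot_eps //; lia.
  - move=> ? ? ->; set w := _ + _; suff -> : dot w w = 2 by rewrite dvdz_mulr.
    by rewrite !dotE !dot_eps //; lia.
  - by move=> ? ->; rewrite dot_eps // eqxx dvd1z.
  - move=> ? ->; rewrite !dotMnl dotMnr dot_eps // eqxx mul1r.
    by rewrite [_ * 2]mulrC mulrA dvdz_mulr.
case/rootsP=> [/pos//|/pos]; move/(_ s); by rewrite !dotE opprK mulrN rpredN.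
Qed.

Lemma pos_root_height T (r : 'rV[int]_(dim T)) :
  (0 < d)%N -> (T = TypeD -> 1 < d)%N -> r \in pos_roots T d ->
  (0 < height r)%N /\ height2 r = 2 * (height r)%:Z.
Proof.
move=> d_gt0 d_gt1 /pos_rootP pos_r.
suff [k k_gt0 Dk]: exists2 k, (0 < k)%N & height2 r = 2 * k%:Z.
  by rewrite /height Dk; lia.
case: pos_r => [i j|i j nA|i tB|i tC] => [lt_ij lt_jn|lt_ij lt_jn|lt_in|lt_in].
- move->; exists (j - i)%N; first lia.
  rewrite !heightE !height2_eps //; last lia.
  by rewrite /height_weight; case: (T); lia.
- move->; rewrite !heightE !height2_eps //; last lia.
  rewrite /height_weight /ambient_dim in lt_jn *;
    case: (T) nA lt_jn d_gt1 => // _ ? ?.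
  + by exists (d - i + (d - j))%N; lia.
  + by exists (d - i + (d - j) - 1)%N; lia.
  + by exists (d - i + (d - j) - 2)%N; lia.
- move->; rewrite height2_eps //.
  rewrite /height_weight tB; exists (d - i)%N; move: lt_in; rewrite tB /=; lia.
- move->; rewrite !heightE height2_eps //.
  rewrite /height_weight tC; exists (2 * (d - i) - 1)%N; move: lt_in;
    rewrite tC /=; lia.
Qed.

Lemma height_simple_root T i :
  (T = TypeD -> 1 < d)%N -> (i < d)%N -> height (simple_root T i) = 1%N.
Proof.
move=> d_gt1 lt_id; rewrite /height.
suff -> : height2 (simple_root T i) = 2 by [].
case: T d_gt1; rewrite /simple_root => d_gt1; last 3 first.
- case: eqP => ?; rewrite ?heightE !(@height2_eps TypeB) /height_weight /=; lia.
- case: eqP => ?; rewrite ?heightE !(@height2_eps TypeC) /height_weight /=; lia.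
- have := d_gt1 erefl.
  by case: eqP => ?; rewrite ?heightE !(@height2_eps TypeD) /height_weight /=;
    lia.
- by rewrite !heightE !(@height2_eps TypeA) /height_weight /=; lia.
Qed.

Lemma simple_root_pos T i :
  (T = TypeD -> 1 < d)%N -> (i < d)%N -> simple_root T i \in pos_roots T d.
Proof.
move=> d_gt1 lt_id; apply/pos_rootP.
case: T d_gt1; rewrite /simple_root => d_gt1.
- by apply: (@PosDiff TypeA _ i i.+1).
- case: eqP => ?; first by apply: (@PosShort TypeB _ i).
  by apply: (@PosDiff TypeB _ i i.+1) => //=; lia.
- case: eqP => ?; first by apply: (@PosLong TypeC _ i).
  by apply: (@PosDiff TypeC _ i i.+1) => //=; lia.
- have := d_gt1 erefl.
  case: eqP => ? ?; first by apply: (@PosSum TypeD _ i.-1 i) => //=; lia.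
  by apply: (@PosDiff TypeD _ i i.+1) => //=; lia.
Qed.

End ClassicalRoots.

(** * Root strings *)

Section RootStrings.

Local Open Scope ring_scope.

Variables (T : classical_type) (d : nat).
Local Notation Phi := (roots T d).
Local Notation Pos := (pos_roots T d).
Implicit Types r s : 'rV[int]_(ambient_dim T d).

Lemma pos_rootW r : r \in Pos -> r \in Phi.
Proof. by move=> pos_r; apply/rootsP; left. Qed.

Lemma root_mulrn_notin r k : r \in Phi -> (1 < k)%N -> r *+ k \notin Phi.
Proof.
move=> /root_norm Nr k_gt1; have m_gt0 := short_norm_gt0 T.
apply/negP=> /root_norm; rewrite !dotE -mulrA.
have: 4 <= k%:Z * k%:Z by nia.
move: (k%:Z * k%:Z) => kk; nia.
Qed.

(** The squared lengths lie between [m] and [2 * m], where [m] is the smallest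
    one, so that [2 * (r, s) = (r + s, r + s) - (r, r) - (s, s) <= 0]. *)
Lemma root_sum_dot_le0 r s :
  r \in Phi -> s \in Phi -> r + s \in Phi -> dot r s <= 0.
Proof.
move=> /root_norm Nr /root_norm Ns /root_norm.
rewrite !dotE (dotC s r); lia.
Qed.

(** Since [(r, s) <= 0], the squared length of [s - k r] is at least
    [(s, s) + 4 (r, r)] as soon as [k >= 2]. *)
Lemma root_string_bound r s k :
    r \in Phi -> s \in Phi -> r + s \in Phi -> (1 < k)%N ->
  s - r *+ k \notin Phi.
Proof.
move=> Phi_r Phi_s Phi_rs k_gt1; have rs := root_sum_dot_le0 Phi_r Phi_s Phi_rs.
have Nr := root_norm Phi_r; have Ns := root_norm Phi_s.
have m_gt0 := short_norm_gt0 T.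
apply/negP=> /root_norm; rewrite !dotE (dotC s r).
have: dot r s * k%:Z <= 0 by nia.
have: dot r r * 4 <= dot r r * k%:Z * k%:Z.
  have kk: 4 <= k%:Z * k%:Z by nia.
  by rewrite -mulrA; move: (k%:Z * k%:Z) kk => kk; nia.
lia.
Qed.

Lemma chain_downE r s : r \in Phi -> s \in Phi -> r + s \in Phi ->
  chain_down r s = (s - r \in Phi).
Proof.
move=> Phi_r Phi_s Phi_rs; have Phi_gt0: (0 < size Phi)%N.
  by case: (roots T d) Phi_r.
apply/eqP; rewrite eqn_leq /chain_down; apply/andP; split.
  apply/bigmax_leqP=> k; have [k_gt1|] := ltnP 1 k.
    by rewrite (negPf (root_string_bound _ _ _ k_gt1)).
  by case: (k : nat) => [|[|]] // _; rewrite mulr1n => ->.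
case: (boolP (s - r \in Phi)) => // Phi_sr.
by apply: (@leq_bigmax_cond _ _ _ (Ordinal (Phi_gt0 : (1 < (size Phi).+1)%N))).
Qed.

(** Both [r] and [- r] can be added to [r + s], so that [(r, r + s) = 0]. *)
Lemma root_string_mid r s :
    r \in Phi -> s \in Phi -> r + s \in Phi -> r + (r + s) \in Phi ->
  dot r s = - dot r r.
Proof.
move=> Phi_r Phi_s Phi_rs Phi_2rs.
have Phi_Nr: - r \in Phi by rewrite rootN.
have := root_sum_dot_le0 Phi_r Phi_rs Phi_2rs.
have := root_sum_dot_le0 Phi_Nr Phi_rs; rewrite addKr => /(_ Phi_s).
rewrite !dotE; lia.
Qed.

Lemma root_string3 r s :
    r \in Phi -> s \in Phi -> r + s \in Phi -> r + (r + s) \in Phi ->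
  r + (r + (r + s)) \notin Phi.
Proof.
move=> Phi_r Phi_s Phi_rs Phi_2rs; apply/negP=> Phi_3rs.
have := root_string_mid Phi_r Phi_s Phi_rs Phi_2rs.
have := root_sum_dot_le0 Phi_r Phi_2rs Phi_3rs.
have := root_norm Phi_r; have := short_norm_gt0 T; rewrite !dotE; lia.
Qed.

(** In a string [s, r + s, 2 * r + s] of roots, [r] is short, [s] is long and
    the plane spanned by [r] and [s] carries a root system of type B2. *)
Lemma root_string_B2 r s :
    r \in Phi -> s \in Phi -> r + s \in Phi -> r + (r + s) \in Phi ->
  [/\ s + (r + s) \notin Phi, s + (r + (r + s)) \notin Phi
    & (r + s) + (r + (r + s)) \notin Phi].
Proof.
move=> Phi_r Phi_s Phi_rs Phi_2rs.
have rs := root_string_mid Phi_r Phi_s Phi_rs Phi_2rs.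
have [Nr Ns] : dot r r = short_norm T /\ dot s s = short_norm T *+ 2.
  have := root_norm Phi_r; have := root_norm Phi_s; have := root_norm Phi_rs.
  rewrite !dotE (dotC s r) rs; lia.
have m_gt0 := short_norm_gt0 T.
split; apply/negP=> Phi_sum.
- have := root_sum_dot_le0 Phi_s Phi_rs Phi_sum; rewrite !dotE (dotC s r); lia.
- have := root_norm Phi_sum; rewrite !dotE (dotC s r); lia.
- have := root_sum_dot_le0 Phi_rs Phi_2rs Phi_sum.
  rewrite !dotE (dotC s r); lia.
Qed.

Lemma pos_root_sum r s :
    (0 < d)%N -> (T = TypeD -> 1 < d)%N ->
    r \in Pos -> s \in Pos -> r + s \in Phi ->
  r + s \in Pos.
Proof.
move=> d_gt0 d_gt1 pos_r pos_s /rootsP[] // pos_Nrs.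
have [_] := pos_root_height d_gt0 d_gt1 pos_Nrs.
have [_] := pos_root_height d_gt0 d_gt1 pos_r.
have [] := pos_root_height d_gt0 d_gt1 pos_s.
rewrite !heightE; lia.
Qed.

Lemma pos_root_heightD r s :
    (0 < d)%N -> (T = TypeD -> 1 < d)%N ->
    r \in Pos -> s \in Pos -> r + s \in Pos ->
  height (r + s) = (height r + height s)%N.
Proof.
move=> d_gt0 d_gt1 pos_r pos_s pos_rs.
have [_] := pos_root_height d_gt0 d_gt1 pos_rs.
have [_] := pos_root_height d_gt0 d_gt1 pos_r.
have [_] := pos_root_height d_gt0 d_gt1 pos_s.
rewrite !heightE; lia.
Qed.

Lemma simple_root_diff i : (i.+1 < ambient_dim T d)%N ->
  simple_root d T i = eps (ambient_dim T d) i - eps (ambient_dim T d) i.+1.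
Proof. by rewrite /simple_root; case: T => //= lt_id; rewrite ltn_eqF. Qed.

Lemma ltn_ambient_dim i : (i.+1 < ambient_dim T d -> i < d)%N.
Proof. by case: T => //= /ltnW. Qed.

(** The sum of the last two basis vectors involves the last simple root, the
    only one whose form depends on the type. *)
Lemma pos_root_decomp_last i : T <> TypeA -> i.+2 = d ->
  let r := eps (ambient_dim T d) i + eps (ambient_dim T d) i.+1 in
  r = simple_root d T i.+1 \/ r - simple_root d T i.+1 \in Pos.
Proof.
move=> nA Dd; rewrite /simple_root Dd eqxx; case: T nA => // _.
- right; apply/pos_rootP/(@PosShort _ TypeB _ i) => //; first by rewrite /= -Dd.
  by vector_eq.
- right; apply/pos_rootP/(@PosDiff _ TypeC _ i i.+1) => //=.
    by rewrite -Dd.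
  by vector_eq.
- by left.
Qed.

Lemma pos_root_decomp r : r \in Pos ->
  exists2 i, (i < d)%N &
    r = simple_root d T i \/ r - simple_root d T i \in Pos.
Proof.
set n := ambient_dim T d.
have lt_d := ltn_ambient_dim.
case/pos_rootP=> [i j|i j nA|i tB|i tC] =>
  [lt_ij lt_jn|lt_ij lt_jn|lt_in|lt_in].
- have lt_i1n: (i.+1 < n)%N by apply: leq_ltn_trans lt_jn.
  move->; exists i; rewrite ?lt_d // simple_root_diff //.
  move: lt_ij; rewrite leq_eqVlt => /predU1P[->|lt_ij]; [by left | right].
  by apply/pos_rootP/(@PosDiff _ _ _ i.+1 j) => //; vector_eq.
- have [lt_j1n ->|le_nj1] := ltnP j.+1 n.
    exists j; rewrite ?lt_d // simple_root_diff //; right.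
    by apply/pos_rootP/(@PosSum _ _ _ i j.+1) => //; [lia|vector_eq].
  have lt_i1n: (i.+1 < n)%N by apply: leq_ltn_trans lt_jn.
  have [Dji|ne_ji] := eqVneq j i.+1; last first.
    move->; exists i; rewrite ?lt_d // simple_root_diff //; right.
    by apply/pos_rootP/(@PosSum _ _ _ i.+1 j) => //; [lia|vector_eq].
  have Dd: i.+2 = d.
    by rewrite /n in lt_jn le_nj1; case: (T) nA lt_jn le_nj1 => //=; lia.
  move->; exists j; first by rewrite -Dd Dji.
  by rewrite Dji; apply: pos_root_decomp_last.
- have [lt_i1n ->|le_ni1 ->] := ltnP i.+1 n.
    exists i; rewrite ?lt_d // simple_root_diff //; right.
    by apply/pos_rootP/(@PosShort _ _ _ i.+1) => //; vector_eq.
  exists i; [by rewrite /n tB in lt_in | left].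
  have Dd: i.+1 = d by rewrite /n tB in lt_in le_ni1; apply/eqP;
    rewrite eqn_leq lt_in.
  by rewrite /n /simple_root; case: (T) tB => // _; rewrite Dd eqxx.
- have [lt_i1n ->|le_ni1 ->] := ltnP i.+1 n.
    exists i; rewrite ?lt_d // simple_root_diff //; right.
    by apply/pos_rootP/(@PosSum _ _ _ i i.+1) => //; [rewrite tC|vector_eq].
  exists i; [by rewrite /n tC in lt_in | left].
  have Dd: i.+1 = d by rewrite /n tC in lt_in le_ni1; apply/eqP;
    rewrite eqn_leq lt_in.
  by rewrite /n /simple_root; case: (T) tC => // _; rewrite Dd eqxx.
Qed.

(** Let [u] be positive with [(u, r) > 0], for example [u = r].  As long as no
    simple root has a positive product with [r], the subtraction of simple
    roots from [u] keeps [(u, r)] positive, until [u] is itself simple. *)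
Lemma exists_simple_dot_gt0 r :
    (0 < d)%N -> (T = TypeD -> 1 < d)%N -> r \in Pos ->
  exists2 i, (i < d)%N & 0 < dot (simple_root d T i) r.
Proof.
move=> d_gt0 d_gt1 pos_r; have Phi_r := pos_rootW pos_r.
have rr_gt0: 0 < dot r r.
  by have := root_norm Phi_r; have := short_norm_gt0 T; lia.
suff gen u : u \in Pos -> 0 < dot u r ->
    exists2 i, (i < d)%N & 0 < dot (simple_root d T i) r by apply: (gen r).
have [k] := ubnP (height u); elim: k u => // k IHk u lt_uk pos_u ur.
have [i lt_id [Du|pos_v]] := pos_root_decomp pos_u.
  by exists i; rewrite // -Du.
have [i_r|i_r] := ltrP 0 (dot (simple_root d T i) r); first by exists i.
have pos_i := simple_root_pos d_gt1 lt_id.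
apply: (IHk _ _ pos_v); last by rewrite !dotE; lia.
have := pos_root_heightD d_gt0 d_gt1 pos_v pos_i.
rewrite subrK height_simple_root // => /(_ pos_u) Du.
by move: lt_uk; rewrite Du addn1.
Qed.

End RootStrings.

(** * The integral form of the adjoint representation *)

Section LieBracket.

Local Open Scope ring_scope.

Variables (K : fieldType) (L : vectType K) (br : L -> L -> L).
Hypothesis br_lie : lie_bracket br.
Implicit Types x y z : L.

Lemma brDr x y z : br x (y + z) = br x y + br x z.
Proof. by case: br_lie => /(_ x 1 y z); rewrite !scale1r. Qed.

Lemma br0r x : br x 0 = 0.
Proof. by apply: (addrI (br x 0)); rewrite -brDr !addr0. Qed.

Lemma brZr x a y : br x (a *: y) = a *: br x y.
Proof. by case: br_lie => /(_ x a y 0); rewrite br0r !addr0. Qed.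

Lemma brNr x y : br x (- y) = - br x y.
Proof. by rewrite -scaleN1r brZr scaleN1r. Qed.

Lemma brMzr x y m : br x (y *~ m) = br x y *~ m.
Proof. by rewrite -!scaler_int brZr. Qed.

Lemma brDl x y z : br (x + y) z = br x z + br y z.
Proof. by case: br_lie => _ /(_ z 1 x y); rewrite !scale1r. Qed.

Lemma brxx x : br x x = 0.
Proof. by case: br_lie. Qed.

Lemma brC x y : br x y = - br y x.
Proof.
have := brxx (x + y); rewrite brDl !brDr !brxx add0r addr0 => /eqP.
by rewrite addr_eq0 => /eqP.
Qed.

Lemma brMzl x y m : br (x *~ m) y = br x y *~ m.
Proof. by rewrite brC brMzr brC mulNrz opprK. Qed.

Lemma br_jacobi x y z : br (br x y) z = br x (br y z) - br y (br x z).
Proof.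
have [_ _ _ /(_ x y z)] := br_lie.
by move/eqP; rewrite (brC z x) brNr (brC z (br x y)) subr_eq0 => /eqP.
Qed.

Lemma br_sum x (I : Type) (s : seq I) F :
  br x (\sum_(i <- s) F i) = \sum_(i <- s) br x (F i).
Proof. exact: (big_morph _ (brDr x) (br0r x)). Qed.

End LieBracket.

Section CoordinateMatrices.

Local Open Scope ring_scope.

Variables (K : fieldType) (L : vectType K) (br : L -> L -> L).
Hypothesis br_lie : lie_bracket br.
Variables (N : nat) (b : N.-tuple L).
Hypothesis b_basis : basis_of fullv b.

Lemma coord_basisE x : x = \sum_(i < N) coord b i x *: tnth b i.
Proof.
rewrite {1}(coord_basis b_basis (memvf x)).
by apply: eq_bigr => i _; rewrite (tnth_nth 0).
Qed.

Lemma coord_tnth i j : coord b i (tnth b j) = (i == j)%:R.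
Proof.
by rewrite (tnth_nth 0) coord_free ?(basis_free b_basis) // eq_sym.
Qed.

Lemma ad_mxM x (A : 'M[K]_N) (f : L -> L) :
  (forall i j, A i j = coord b i (f (tnth b j))) ->
  forall i j, (ad_mx br b x *m A) i j = coord b i (br x (f (tnth b j))).
Proof.
move=> DA i j; rewrite [f _]coord_basisE br_sum // linear_sum mxE.
by apply: eq_bigr => k _; rewrite brZr // linearZ /= mulrC mxE DA.
Qed.

Lemma ad_mxM2 x y i j :
  (ad_mx br b x *m ad_mx br b y) i j = coord b i (br x (br y (tnth b j))).
Proof. by apply: (@ad_mxM _ _ (br y)) => i' j'; rewrite mxE. Qed.

Lemma ad_mxM3 x y z i j :
  (ad_mx br b x *m (ad_mx br b y *m ad_mx br b z)) i j
    = coord b i (br x (br y (br z (tnth b j)))).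
Proof. by apply: (@ad_mxM _ _ (fun u => br y (br z u))); apply: ad_mxM2. Qed.

Lemma ad_mx_br x y :
  ad_mx br b (br x y)
    = ad_mx br b x *m ad_mx br b y - ad_mx br b y *m ad_mx br b x.
Proof.
by apply/matrixP=> i j; rewrite [LHS]mxE [RHS]mxE [X in _ + X]mxE !ad_mxM2
  -linearB -br_jacobi.
Qed.

Lemma ad_mxMz x m : ad_mx br b (x *~ m) = ad_mx br b x *~ m.
Proof.
by apply/matrixP=> i j; rewrite -[in RHS]scaler_int !mxE brMzl // -scaler_int
  linearZ.
Qed.

End CoordinateMatrices.

Lemma eq_abs1 (c : int) : `|c|%N = 1%N -> (c = 1 \/ c = -1)%R.
Proof. lia. Qed.

Lemma eq_abs2 (c : int) : `|c|%N = 2%N -> (c = 2 \/ c = -2)%R.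
Proof. lia. Qed.

Section ChevalleyMatrices.

Local Open Scope ring_scope.

Variables (T : classical_type) (d : nat).
Hypotheses (d_gt0 : (0 < d)%N) (d_gt1 : T = TypeD -> (1 < d)%N).
Variables (K : archiNumFieldType) (L : vectType K) (br : L -> L -> L).
Variables h e : 'rV[int]_(ambient_dim T d) -> L.
Hypotheses (br_lie : lie_bracket br) (he_basis : chevalley_basis br h e).

Local Notation Phi := (roots T d).
Local Notation Pos := (pos_roots T d).
Local Notation al := (simple_root d T).
Local Notation b := (chevalley_tuple h e).
Local Notation N := (size (simple_roots T d) + size (roots T d))%N.
Implicit Types r s t : 'rV[int]_(ambient_dim T d).

Let b_basis : basis_of fullv b. Proof. by case: he_basis. Qed.

Lemma br_h_e r s : r \in Phi -> s \in Phi ->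
  br (h r) (e s) = e s *~ cartan_int r s.
Proof. by case: he_basis => _ H Pr Ps; case: (H r s Pr Ps). Qed.

Lemma br_e_eN r : r \in Phi -> br (e r) (e (- r)) = h r.
Proof. by case: he_basis => _ H Pr; case: (H r r Pr Pr). Qed.

Lemma br_e_e0 r s : r \in Phi -> s \in Phi ->
  r + s != 0 -> r + s \notin Phi -> br (e r) (e s) = 0.
Proof. by case: he_basis => _ H Pr Ps; case: (H r s Pr Ps). Qed.

Lemma br_e_e r s : r \in Phi -> s \in Phi -> r + s \in Phi ->
  exists2 c : int, `|c|%N = (s - r \in Phi).+1
                 & br (e r) (e s) = e (r + s) *~ c.
Proof.
move=> Phi_r Phi_s Phi_rs; case: he_basis => _ /(_ r s Phi_r Phi_s)[_ _ _ _].
case/(_ Phi_rs) => ->; rewrite chain_downE //.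
  by exists (s - r \in Phi).+1.
by exists (- (s - r \in Phi).+1%:Z); rewrite ?abszN // mulrNz.
Qed.

(** This is the Jacobi identity for [e r], [e s] and [e (- (r + s))], where
    [c], [c1] and [c2] are structure constants. *)
Lemma coroot_sum r s : r \in Phi -> s \in Phi -> r + s \in Phi ->
  exists c : int, exists c1 : int, exists c2 : int,
   [/\ h (r + s) *~ c = h r *~ c1 - h s *~ c2, `|c|%N = (s - r \in Phi).+1,
       `|c1|%N = (s + (r + s) \in Phi).+1 & `|c2|%N = (r + (r + s) \in Phi).+1].
Proof.
move=> Phi_r Phi_s Phi_rs.
have Dr: s - (r + s) = - r by rewrite opprD addrCA subrr addr0.
have Ds: r - (r + s) = - s by rewrite opprD addrA subrr add0r.
have [c Nc Dc] := br_e_e Phi_r Phi_s Phi_rs.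
have [|||c1 Nc1 Dc1] := @br_e_e s (- (r + s)); rewrite ?Dr ?rootN //.
have [|||c2 Nc2 Dc2] := @br_e_e r (- (r + s)); rewrite ?Ds ?rootN //.
exists c, c1, c2; split=> //; last first.
- by rewrite Nc2 -rootN opprB opprK.
- by rewrite Nc1 -rootN opprB opprK.
rewrite -br_e_eN // -brMzl // -Dc br_jacobi // Dc1 Dc2 !brMzr // Dr Ds.
by rewrite !br_e_eN.
Qed.

(** Only the simple coroots belong to the basis, so that the integrality of
    [ad e_r] requires that the other coroots be integral combinations of
    them. *)
Definition coroot_lattice (x : L) : Prop :=
  exists z : nat -> int, x = \sum_(i < d) h (al i) *~ z i.

Lemma coroot_latticeB x y :
  coroot_lattice x -> coroot_lattice y -> coroot_lattice (x - y).
Proof.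
case=> z1 -> [z2 ->]; exists (fun i => z1 i - z2 i).
by rewrite -sumrB; apply: eq_bigr => i _; rewrite mulrzBr.
Qed.

Lemma coroot_latticeMz x c : coroot_lattice x -> coroot_lattice (x *~ c).
Proof.
case=> z ->; exists (fun i => z i * c).
by rewrite mulrz_suml; apply: eq_bigr => i _; rewrite mulrzA.
Qed.

Lemma coroot_lattice_simple i : (i < d)%N -> coroot_lattice (h (al i)).
Proof.
move=> lt_id; exists (fun j => (j == i)%:Z).
rewrite (bigD1 (Ordinal lt_id)) //= eqxx big1 ?addr0 // => j.
by rewrite -val_eqE /= => /negPf->; rewrite mulr0z.
Qed.

Lemma coroot_latticeN x : coroot_lattice (- x) -> coroot_lattice x.
Proof. by move/(@coroot_latticeMz _ (-1)); rewrite mulrN1z opprK. Qed.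

(** When [s - t] is a root too, the coroot of [s + t] is the sum of those of
    [s - t] and [t] although the bracket of [e s] and [e t] is divisible by 2:
    the halves that the Jacobi identity yields cancel out. *)
Lemma coroot_lattice_B2 s t :
    s \in Phi -> t \in Phi -> s - t \in Phi -> s + t \in Phi ->
    coroot_lattice (h t) -> coroot_lattice (h (s - t)) ->
  coroot_lattice (h (s + t)).
Proof.
move=> Phi_s Phi_t Phi_u; have Ds: t + (s - t) = s by rewrite addrC subrK.
have Du: t + (t + (s - t)) = s + t by rewrite Ds addrC.
move=> Phi_v Lt Lu.
have Phi_Ds : t + (s - t) \in Phi by rewrite Ds.
have Phi_Du : t + (t + (s - t)) \in Phi by rewrite Du.
have [out1 _ out2] := root_string_B2 Phi_t Phi_u Phi_Ds Phi_Du.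
have out3 := root_string3 Phi_t Phi_u Phi_Ds Phi_Du.
move: out1 out2 out3; rewrite Ds [t + s]addrC => out1 out2 out3.
have Phi_ut: s - t + t \in Phi by rewrite subrK.
have [c [c1 [c2 []]]] := coroot_sum Phi_u Phi_t Phi_ut.
rewrite subrK [t + s]addrC Phi_v (negPf out1) => Dh.
have -> : (t - (s - t) \in Phi) = false.
  apply: negbTE; rewrite -rootN opprB -addrA -opprD -mulr2n.
  by apply: root_string_bound => //; rewrite addrC.
move=> /eq_abs1 Nc /eq_abs2 Nc1 /eq_abs1 Nc2.
have [c' [c1' [c2' []]]] := coroot_sum Phi_s Phi_t Phi_v.
rewrite -rootN opprB Phi_u (negPf out2) (negPf out3).
move=> Dh' /eq_abs2 Nc' /eq_abs1 Nc1' /eq_abs1 Nc2'.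
have [a Da]: exists a : int, c' * a = 2.
  by case: Nc' => ->; [exists 1 | exists (-1)].
have Dhs : h s = h (s - t) *~ (c1 * c) - h t *~ (c2 * c).
  by rewrite -[h s]mulr1z (_ : 1 = c * c) ?mulrzA ?Dh ?mulrzBl //;
    case: Nc => ->.
have [x Dx]: exists x : int, c1 * c * c1' * a = x * 2.
  have [k Dk]: exists k, c1 = 2 * k.
    by case: Nc1 => ->; [exists 1 | exists (-1)].
  by exists (k * c * c1' * a); rewrite Dk [RHS]mulrC !mulrA.
have [y Dy]: exists y : int, c2 * c * c1' * a + c2' * a = y * 2.
  have [k Dk]: exists k, c2 * c * c1' + c2' = k * 2.
    case: Nc2 Nc Nc1' Nc2' => -> [] -> [] -> [] ->;
    by [exists 1 | exists 0 | exists (-1)].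
  by exists (k * a); rewrite -mulrDl Dk mulrAC.
suff ->: h (s + t) = h (s - t) *~ x - h t *~ y.
  by apply: coroot_latticeB; apply: coroot_latticeMz.
have: h (s + t) *~ 2 = (h (s - t) *~ x - h t *~ y) *~ 2.
  rewrite -{1}Da mulrzA Dh' Dhs !mulrzBl -!mulrzA -Dx.
  by rewrite !mulrA -addrA -opprD -mulrzDr -Dy.
rewrite -!scaler_int; apply: scalerI; by rewrite pnatr_eq0.
Qed.

(** By induction on the height of [s = t + al i]: by [coroot_sum] a multiple of
    [h s] lies in the lattice, and the multiple is [h s] or [- h s] unless
    [t - al i] is a root, which is the case of [coroot_lattice_B2]. *)
Lemma coroot_lattice_root r : r \in Phi -> coroot_lattice (h r).
Proof.
suff gen s : s \in Pos -> coroot_lattice (h s).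
  move=> Phi_r; case/rootsP: (Phi_r) => [/gen//|pos_Nr].
  apply: coroot_latticeN; rewrite -(br_e_eN Phi_r) (brC br_lie) opprK.
  by rewrite -{2}[r]opprK br_e_eN ?rootN //; apply: gen.
have [k] := ubnP (height s); elim: k s => // k IHk s lt_sk pos_s.
have [i lt_id [->|pos_t]] := pos_root_decomp pos_s.
  exact: coroot_lattice_simple.
have pos_i := simple_root_pos d_gt1 lt_id;
  have Li := coroot_lattice_simple lt_id.
have height_al := height_simple_root d_gt1 lt_id.
set t := s - al i in pos_t; have Ds: t + al i = s by rewrite subrK.
have hs : height s = (height t).+1.
  have := pos_root_heightD d_gt0 d_gt1 pos_t pos_i.
  by rewrite Ds height_al addn1; apply.
have Lt: coroot_lattice (h t) by apply: IHk; rewrite // -ltnS -hs.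
have [Phi_t Phi_i] := (pos_rootW pos_t, pos_rootW pos_i).
have Phi_ti: t + al i \in Phi by rewrite Ds pos_rootW.
have [/rootsP[pos_u|pos_Nu]|out] := boolP (t - al i \in Phi).
- rewrite -Ds; apply: coroot_lattice_B2 => //; first exact: pos_rootW.
  have := pos_root_heightD d_gt0 d_gt1 pos_u pos_i.
  rewrite subrK height_al => /(_ pos_t) ht; apply: IHk => //.
  by move: lt_sk; rewrite hs ht; lia.
- have := pos_root_heightD d_gt0 d_gt1 pos_Nu pos_t.
  rewrite opprB subrK height_al => /(_ pos_i).
  have [] := pos_root_height d_gt0 d_gt1 pos_Nu; rewrite opprB.
  have [] := pos_root_height d_gt0 d_gt1 pos_t; lia.
have [c [c1 [c2 []]]] := coroot_sum Phi_t Phi_i Phi_ti.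
rewrite -rootN opprB (negPf out) Ds => Dh /eq_abs1 Nc _ _.
suff ->: h s = (h t *~ c1 - h (al i) *~ c2) *~ c.
  by apply/coroot_latticeMz/coroot_latticeB; apply: coroot_latticeMz.
by rewrite -Dh -mulrzA; case: Nc => ->.
Qed.

Lemma size_simple_roots : size (simple_roots T d) = d.
Proof. by rewrite simple_rootsE // size_map size_iota. Qed.

Lemma nth_simple_roots i :
  (i < d)%N -> nth 0 (simple_roots T d) i = al i.
Proof.
by move=> lt_id; rewrite simple_rootsE // (nth_map 0%N) ?size_iota ?nth_iota.
Qed.

Lemma simple_root_inj : injective (fun i : 'I_d => al i).
Proof.
have uniq_simple : uniq (simple_roots T d).
  have := free_uniq (basis_free b_basis);
    rewrite /= cat_uniq => /andP[uniq_h _].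
  exact: map_uniq uniq_h.
move=> i j /eqP; rewrite -!nth_simple_roots ?ltn_ord //.
by rewrite nth_uniq ?size_simple_roots // => /eqP/val_inj.
Qed.

Lemma tnth_coroot (i : 'I_(size (simple_roots T d))) :
  tnth b (lshift _ i) = h (al i).
Proof.
have lt_id: (i < d)%N by rewrite -[X in (_ < X)%N]size_simple_roots.
by rewrite tnth_lshift tnth_map (tnth_nth 0) /= nth_simple_roots.
Qed.

Lemma tnth_root_vector (i : 'I_(size Phi)) :
  tnth b (rshift _ i) = e (tnth (in_tuple Phi) i).
Proof. by rewrite tnth_rshift tnth_map. Qed.

(** In the grading of the Lie algebra by twice the height, coroots have degree
    0 and [ad e_r] has degree [height2 r]. *)
Definition basis_height (j : 'I_N) : int :=
  if split j is inr k then height2 (tnth (in_tuple Phi) k) else 0.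

Variant basis_spec (x : L) (w : int) : Prop :=
| BasisCoroot i of (i < d)%N & x = h (al i) & w = 0
| BasisRoot s of s \in Phi & x = e s & w = height2 s.

Lemma basis_height_coroot i : basis_height (lshift _ i) = 0.
Proof. by rewrite /basis_height (unsplitK (inl i)). Qed.

Lemma basis_height_root i :
  basis_height (rshift _ i) = height2 (tnth (in_tuple Phi) i).
Proof. by rewrite /basis_height (unsplitK (inr i)). Qed.

Lemma basisP j : basis_spec (tnth b j) (basis_height j).
Proof.
rewrite -(splitK j); case: (split j) => i /=.
  rewrite tnth_coroot basis_height_coroot; apply: (@BasisCoroot _ _ i) => //.
  by rewrite -[X in (_ < X)%N]size_simple_roots.
rewrite tnth_root_vector basis_height_root.
by apply: (@BasisRoot _ _ (tnth (in_tuple Phi) i)) => //; apply: mem_tnth.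
Qed.

Lemma root_vector_index r : r \in Phi ->
  exists2 i : 'I_(size Phi), r = tnth (in_tuple Phi) i
    & tnth b (rshift _ i) = e r.
Proof.
case/(tnthP (in_tuple Phi))=> i ->.
by exists i => //; rewrite tnth_root_vector.
Qed.

Lemma coroot_index i : (i < d)%N ->
  exists2 j : 'I_N, tnth b j = h (al i) & basis_height j = 0.
Proof.
move=> lt_id; have lt_i: (i < size (simple_roots T d))%N.
  by rewrite size_simple_roots.
exists (lshift _ (Ordinal lt_i)); first by rewrite tnth_coroot.
exact: basis_height_coroot.
Qed.

Lemma al_root i : (i < d)%N -> al i \in Phi.
Proof. by move=> lt_id; apply/pos_rootW/simple_root_pos. Qed.

Lemma cartan_int_rr r : r \in Phi -> cartan_int r r = 2.
Proof.
move=> Phi_r; rewrite /cartan_int mulzK //.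
by have := root_norm Phi_r; have := short_norm_gt0 T; lia.
Qed.

Lemma br_e_h r s : r \in Phi -> s \in Phi ->
  br (e r) (h s) = - (e r *~ cartan_int s r).
Proof. by move=> Phi_r Phi_s; rewrite (brC br_lie) br_h_e. Qed.

Lemma br_e_cases r s : r \in Phi -> s \in Phi ->
  [\/ s = - r, br (e r) (e s) = 0 | r + s \in Phi].
Proof.
move=> Phi_r Phi_s; have [r_s|nr_s] := eqVneq (r + s) 0.
  by constructor 1; apply/eqP; rewrite -addr_eq0 addrC r_s.
have [Phi_rs|nPhi_rs] := boolP (r + s \in Phi); first by constructor 3.
by constructor 2; apply: br_e_e0.
Qed.

(** The squares of the root vectors are divisible by 2 as operators, and their
    cubes vanish, because no root string has more than three elements. *)
Lemma ad_root_sqr r j : r \in Phi ->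
  exists t, exists v : int,
    [/\ t \in Phi, br (e r) (e t) = 0
      & br (e r) (br (e r) (tnth b j)) = e t *~ v *~ 2].
Proof.
move=> Phi_r; have brxx := brxx br_lie; have br0r := br0r br_lie.
have zero x : br (e r) x = 0 -> exists t, exists v : int,
    [/\ t \in Phi, br (e r) (e t) = 0 & br (e r) x = e t *~ v *~ 2].
  by move=> ->; exists r, 0; rewrite brxx !mul0rz.
case: (basisP j) => [i lt_id -> _|s Phi_s -> _].
  by apply: zero; rewrite br_e_h ?al_root // (brNr br_lie) (brMzr br_lie) brxx
    mul0rz oppr0.
case: (br_e_cases Phi_r Phi_s) => [->|-> //|Phi_rs].
- rewrite br_e_eN // br_e_h // cartan_int_rr //; exists r, (-1).
  by rewrite brxx mulrN1z mulNrz.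
- by apply: zero; rewrite br0r.
have [c _ ->] := br_e_e Phi_r Phi_s Phi_rs.
rewrite (brMzr br_lie).
case: (br_e_cases Phi_r Phi_rs) => [rs|rs|Phi_2rs].
- have Ds: s = - (r *+ 2) by rewrite mulr2n opprD -{1}rs addrC addKr.
  by move: Phi_s; rewrite Ds rootN (negPf (root_mulrn_notin Phi_r _)).
- by rewrite rs mul0rz; exists r, 0; rewrite brxx !mul0rz.
have [c' Nc' ->] := br_e_e Phi_r Phi_rs Phi_2rs.
have [v Dv]: exists v, c' * c = v * 2.
  move: Nc'; rewrite addrAC subrr add0r Phi_s => /eq_abs2[]->.
    by exists c; rewrite mulrC.
  by exists (- c); rewrite mulrC mulrN mulNr.
exists (r + (r + s)), v; split=> //; last by rewrite -!mulrzA Dv.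
case: (br_e_cases Phi_r Phi_2rs) => [r3s|//|Phi_3rs].
  have Ds: s = - (r *+ 3).
    by rewrite mulrS mulr2n !opprD -{1}r3s addrC -addrA !addKr.
  by move: Phi_s; rewrite Ds rootN (negPf (root_mulrn_notin Phi_r _)).
by have := root_string3 Phi_r Phi_s Phi_rs Phi_2rs; rewrite Phi_3rs.
Qed.

Definition int_coords x := forall i, coord b i x \is a Num.int.

Lemma int_coordsMz x m : int_coords x -> int_coords (x *~ m).
Proof. by move=> Zx i; rewrite -scaler_int linearZ /= rpredM // rpred_int. Qed.

Lemma int_coords_basis j : int_coords (tnth b j).
Proof. by move=> i; rewrite coord_tnth // rpred_nat. Qed.

Lemma int_coords_root r : r \in Phi -> int_coords (e r).
Proof. by case/root_vector_index=> j _ <-; apply: int_coords_basis. Qed.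

Lemma int_coords_coroot r : r \in Phi -> int_coords (h r).
Proof.
case/coroot_lattice_root=> z -> i; rewrite linear_sum rpred_sum // => j _.
have [k <- _] := coroot_index (ltn_ord j).
by apply: int_coordsMz; apply: int_coords_basis.
Qed.

Lemma int_coords_ad r j : r \in Phi -> int_coords (br (e r) (tnth b j)).
Proof.
move=> Phi_r; case: (basisP j) => [i lt_id -> _|s Phi_s -> _].
  rewrite br_e_h ?al_root // -mulrNz.
  by apply: int_coordsMz; apply: int_coords_root.
case: (br_e_cases Phi_r Phi_s) => [->|->|Phi_rs].
- by rewrite br_e_eN //; apply: int_coords_coroot.
- by move=> i; rewrite linear0 rpred0.
by have [c _ ->] := br_e_e Phi_r Phi_s Phi_rs;
  apply/int_coordsMz/int_coords_root.
Qed.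

(** The entries are integers, by [int_coords_ad], so that [Num.floor] only
    changes their type. *)
Definition int_ad r : 'M[int]_N := map_mx Num.floor (ad_mx br b (e r)).

Lemma int_adE r : r \in Phi -> map_mx intr (int_ad r) = ad_mx br b (e r).
Proof.
move=> Phi_r; apply/matrixP=> i j; rewrite !mxE floorK //.
exact: int_coords_ad.
Qed.

Lemma map_intr_inj m n :
  injective (map_mx intr : 'M[int]_(m, n) -> 'M[K]_(m, n)).
Proof.
move=> A B /matrixP eqAB; apply/matrixP=> i j; apply: (@intr_inj K).
by have := eqAB i j; rewrite !mxE.
Qed.

Lemma int_ad_cube r : r \in Phi -> int_ad r *m (int_ad r *m int_ad r) = 0.
Proof.
move=> Phi_r; apply: map_intr_inj; rewrite !map_mxM !int_adE // map_mx0.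
apply/matrixP=> i j; rewrite ad_mxM3 // mxE.
have [t [v [_ ert ->]]] := ad_root_sqr j Phi_r.
by rewrite !(brMzr br_lie) ert !mul0rz linear0.
Qed.

Lemma int_ad_sqr r : r \in Phi ->
  exists2 B : 'M[int]_N, int_ad r *m int_ad r = B *+ 2
    & map_mx intr B = 2^-1 *: (ad_mx br b (e r) *m ad_mx br b (e r)).
Proof.
move=> Phi_r; pose A := ad_mx br b (e r).
have DB: map_mx intr (map_mx Num.floor (2^-1 *: (A *m A))) = 2^-1 *: (A *m A).
  apply/matrixP=> i j; rewrite 2!mxE floorK // mxE ad_mxM2 //.
  have [t [v [Phi_t _ ->]]] := ad_root_sqr j Phi_r.
  rewrite -[_ *~ 2]scaler_int linearZ /= mulKf ?pnatr_eq0 //.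
  by apply: int_coordsMz; apply: int_coords_root.
exists (map_mx Num.floor (2^-1 *: (A *m A))) => //.
apply: map_intr_inj; rewrite map_mxM !int_adE // mulr2n map_mxD DB.
by rewrite -scalerDl -mulr2n -[_ *+ 2]mulr_natl divff ?pnatr_eq0 // scale1r.
Qed.

Lemma int_ad_br r s : r \in Phi -> s \in Phi -> r + s \in Phi ->
  exists2 c : int, `|c|%N = (s - r \in Phi).+1
    & int_ad r *m int_ad s = int_ad s *m int_ad r + int_ad (r + s) *~ c.
Proof.
move=> Phi_r Phi_s Phi_rs; have [c Nc Dc] := br_e_e Phi_r Phi_s Phi_rs.
exists c => //; apply: map_intr_inj;
  rewrite map_mxD !map_mxM raddfMz /= !int_adE //.
by rewrite -ad_mxMz // -Dc ad_mx_br // addrC subrK.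
Qed.

Lemma int_ad_comm r s : r \in Phi -> s \in Phi -> r + s != 0 ->
  r + s \notin Phi -> int_ad r *m int_ad s = int_ad s *m int_ad r.
Proof.
move=> Phi_r Phi_s nz_rs nPhi_rs.
apply: map_intr_inj; rewrite !map_mxM /= !int_adE //; apply/eqP.
rewrite -subr_eq0 -ad_mx_br // br_e_e0 //; apply/eqP/matrixP=> i j.
by rewrite !mxE -(mulr0z (0 : L)) (brMzl br_lie) mulr0z linear0.
Qed.

Lemma coord_root_height r i :
  r \in Phi -> coord b i (e r) != 0 -> basis_height i = height2 r.
Proof.
case/root_vector_index=> j Dr <-; rewrite coord_tnth //.
have [-> _|_] := eqVneq i (rshift _ j); last by rewrite eqxx.
by rewrite basis_height_root -Dr.
Qed.

Lemma coord_coroot_height r i :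
  r \in Phi -> coord b i (h r) != 0 -> basis_height i = 0.
Proof.
case/coroot_lattice_root=> z ->; apply: contraNeq => nz_i.
rewrite linear_sum big1 // => k _; have [j <- wj] := coroot_index (ltn_ord k).
rewrite -scaler_int linearZ /= coord_tnth //.
have [Dij|_] := eqVneq i j; last by rewrite mulr0.
by rewrite Dij wj eqxx in nz_i.
Qed.

Lemma int_ad_graded r i j : r \in Phi -> int_ad r i j != 0 ->
  basis_height i = basis_height j + height2 r.
Proof.
move=> Phi_r; rewrite -(intr_eq0 K) => nz.
have {nz}: coord b i (br (e r) (tnth b j)) != 0.
  by have /matrixP/(_ i j) := int_adE Phi_r; rewrite [LHS]mxE [RHS]mxE => <-.
have coordMz x m : coord b i (x *~ m) != 0 -> coord b i x != 0.
  by rewrite -scaler_int linearZ mulf_eq0 => /norP[].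
case: (basisP j) => [k lt_kd -> -> |s Phi_s -> ->].
  rewrite br_e_h ?al_root // linearN oppr_eq0 add0r => /coordMz.
  exact: coord_root_height.
case: (br_e_cases Phi_r Phi_s) => [->|->|Phi_rs].
- by rewrite br_e_eN // height2N addNr; apply: coord_coroot_height.
- by rewrite linear0 eqxx.
have [c _ ->] := br_e_e Phi_r Phi_s Phi_rs.
by move/coordMz/(coord_root_height Phi_rs); rewrite height2D addrC.
Qed.

(** Let [A], [S], [D] be the products of [al i] and [s].  From
    [A + S - 2 D >= 0] and [S <= 2 A] follows that [2 D / A] is at most 3; if it
    were 3 then [S = 2 A], and [2 D / S = 3 / 2] would not be an integer. *)
Lemma cartan_int_simple i s : (i < d)%N -> s \in Phi -> 0 < dot (al i) s ->
  1 <= cartan_int (al i) s <= 2.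
Proof.
move=> lt_id Phi_s dot_gt0; have Phi_i := al_root lt_id.
have := root_dvd Phi_s Phi_i; have := root_dvd Phi_i Phi_s.
rewrite /cartan_int (dotC s) => /dvdzP[q Dq] /dvdzP[q' Dq'].
have Ni := root_norm Phi_i; have Ns := root_norm Phi_s.
have m_gt0 := short_norm_gt0 T.
have sq_ge0 : 0 <= dot (al i - s) (al i - s).
  by apply: sumr_ge0 => k _; rewrite -expr2 sqr_ge0.
rewrite Dq mulzK; last lia.
move: sq_ge0 Ni Ns m_gt0 dot_gt0 Dq Dq'; rewrite !dotE (dotC s).
move: (dot _ _) (dot _ _) (dot _ _) (short_norm T) =>
  S D A m {Phi_i Phi_s lt_id}.
move=> sq_ge0 Ni Ns m_gt0 D_gt0 Dq Dq'.
have q_gt0: 0 < q by nia.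
have q_le3: q <= 3 by nia.
suff: q != 3 by lia.
apply/eqP=> q3; rewrite {}q3 in Dq; have SA: S = 2 * A by lia.
have: q' * 2 * A = 3 * A by rewrite -mulrA -SA -Dq' Dq.
have A_nz: A != 0 by lia.
by move/(mulIf A_nz); lia.
Qed.

(** Take the row of [e s] and the column of a simple coroot.  As [ad e_r] maps
    this coroot to a multiple of [e r], the entry is 0 unless [r = s], when it
    is the opposite of a Cartan integer; this integer is 1 or 2 if the simple
    root has a positive product with [s]. *)
Lemma int_ad_detect s : s \in Pos ->
  exists i, exists j, exists k : int,
    [/\ basis_height i = height2 s, basis_height j = 0, (0 < `|k| < 3)%N
      & {in Pos, forall r, int_ad r i j = if r == s then k else 0}].
Proof.
move=> pos_s; have Phi_s := pos_rootW pos_s.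
have [l lt_ld dot_gt0] := exists_simple_dot_gt0 d_gt0 d_gt1 pos_s.
have [j Dj wj] := coroot_index lt_ld; have Phi_l := al_root lt_ld.
have [i Ds Di] := root_vector_index Phi_s.
exists (rshift _ i), j, (- cartan_int (al l) s).
rewrite basis_height_root -Ds; split=> // [|r /pos_rootW Phi_r].
  by rewrite abszN; have := cartan_int_simple lt_ld Phi_s dot_gt0; lia.
apply: (@intr_inj K); have /matrixP/(_ (rshift _ i) j) := int_adE Phi_r.
rewrite [LHS]mxE [RHS]mxE => ->;
  rewrite Dj br_e_h // -mulrNz -scaler_int linearZ /=.
have [->|ne_rs] := eqVneq r s; first by rewrite -Di coord_tnth // eqxx mulr1.
have [k Dr <-] := root_vector_index Phi_r; rewrite coord_tnth //.
rewrite (inj_eq (@rshift_inj _ _)); have [Dik|_] := eqVneq i k.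
  by rewrite Dr -Dik -Ds eqxx in ne_rs.
by rewrite mulr0.
Qed.

Lemma floor_intrK p m n (B : 'M[int]_(m, n)) :
  map_mx (fun z : K => (Num.floor z)%:~R : 'F_p) (map_mx intr B)
    = map_mx intr B.
Proof. by apply/matrixP=> i j; rewrite !mxE intrKfloor. Qed.

(** All the terms of degree at least 3 of the exponential series vanish. *)
Lemma root_mxE p r (t : 'F_p) : r \in Phi -> 2 != 0 :> 'F_p ->
  let A : 'M['F_p]_N := map_mx intr (int_ad r) in
  root_mx br h e r t = 1%:M + t *: A + (t ^+ 2 / 2) *: (A *m A).
Proof.
move=> Phi_r two_neq0 A; rewrite /root_mx /exp_mod.
have floorE B := floor_intrK p (B : 'M[int]_N).
set M := ad_mx _ _ _; have M3 : M ^+ 3 = 0.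
  have /(congr1 (map_mx (intr : int -> K))) := int_ad_cube Phi_r.
  by rewrite !map_mxM map_mx0 !int_adE.
have N_gt1 : (2 < N.+1)%N.
  rewrite ltnS size_simple_roots -(addn1 1) leq_add //.
  by case: (roots T d) Phi_r.
rewrite -(big_mkord xpredT (fun k => t ^+ k *:
  map_mx (fun z : K => (Num.floor z)%:~R) ((k`!%:R)^-1 *: M ^+ k))).
rewrite big_ltn // big_ltn; last exact: ltn_trans N_gt1.
rewrite big_ltn // big_nat_cond big1 ?addr0 => [|k /andP[/andP[k_gt2 _] _]];
  last first.
  by rewrite -(subnK k_gt2) [M ^+ _]exprD M3 mulr0 scaler0 -(map_mx0 intr)
    floorE map_mx0 scaler0.
have [B DB DM] := int_ad_sqr Phi_r.
have -> : (2`!%:R)^-1 *: M ^+ 2 = map_mx intr B by rewrite DM expr2.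
have -> : (1`!%:R)^-1 *: M ^+ 1 = map_mx intr (int_ad r).
  by rewrite expr1 invr1 scale1r int_adE.
have -> : (0`!%:R)^-1 *: M ^+ 0 = map_mx intr (1%:M).
  by rewrite expr0 invr1 scale1r map_scalar_mx rmorph1.
rewrite !floorE expr0 scale1r expr1 addrA map_scalar_mx rmorph1; congr (_ + _).
by rewrite -map_mxM DB raddfMn /= -scaler_nat scalerA divfK.
Qed.

End ChevalleyMatrices.

(** * Truncated exponentials *)

Section StringIdentities.

Local Open Scope ring_scope.

Variable R : pzRingType.
Hypothesis R_torsion_free : forall (x : R) k, x *+ k.+1 = 0 -> x = 0.
Variables X Y Z W : R.
Hypotheses (XY : X * Y = Y * X + Z) (XZ : X * Z = Z * X + W *+ 2).
Hypotheses (XW : X * W = W * X) (ZY : Z * Y = Y * Z).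
Hypotheses (WY : W * Y = Y * W) (WZ : W * Z = Z * W).
Hypotheses (X3 : X * X * X = 0) (Y3 : Y * Y * Y = 0) (Z3 : Z * Z * Z = 0).

Let XYr u : u * X * Y = u * Y * X + u * Z.
Proof. by rewrite -!mulrA XY mulrDr. Qed.
Let XZr u : u * X * Z = u * Z * X + u * W *+ 2.
Proof. by rewrite -!mulrA XZ mulrDr mulrnAr. Qed.
Let XWr u : u * X * W = u * W * X.
Proof. by rewrite -!mulrA XW. Qed.
Let ZYr u : u * Z * Y = u * Y * Z. Proof. by rewrite -!mulrA ZY. Qed.
Let WYr u : u * W * Y = u * Y * W. Proof. by rewrite -!mulrA WY. Qed.
Let WZr u : u * W * Z = u * Z * W. Proof. by rewrite -!mulrA WZ. Qed.
Let X3r u : u * X * X * X = 0.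
Proof. by rewrite -!mulrA [X * (X * X)]mulrA X3 mulr0. Qed.
Let distr := (mulrDl, mulrDr, mulr2n, mulrA, addrA).
Let pushX := (XYr, XZr, XWr, XY, XZ, XW).
Let sortYZW := (ZYr, WYr, WZr, ZY, WY, WZ).

Let normalize := (pushX, distr, sortYZW).

(** Each identity comes from moving [X] to the right of a product that is known
    to vanish; the derivation [ad X] maps Y to Z, Z to 2 * W and W to 0. *)
Lemma string_ZXX : Z * X * X + W * X + W * X = 0.
Proof.
apply: (@R_torsion_free _ 2); rewrite !mulrS mulr0n addr0 ?addrA.
have: X * (X * X * Y) = 0 by rewrite !mulrA X3 mul0r.
rewrite !normalize X3r add0r.
by rewrite (ACl (1*3*4*2*6*7*5*8*9)).
Qed.

Lemma string_WXX : W * X * X = 0.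
Proof.
apply: (@R_torsion_free _ 3); rewrite !mulrS mulr0n addr0 ?addrA.
have: X * (Z * X * X + W * X + W * X) = 0 by rewrite string_ZXX mulr0.
by rewrite !normalize X3r add0r.
Qed.

Lemma string_YYZ : Y * Y * Z = 0.
Proof.
apply: (@R_torsion_free _ 2); rewrite !mulrS mulr0n addr0 ?addrA.
have: X * (Y * Y * Y) = 0 by rewrite Y3 mulr0.
by rewrite !normalize Y3 mul0r add0r.
Qed.

Lemma string_YZZ : Y * Z * Z + Y * Y * W = 0.
Proof.
apply: (@R_torsion_free _ 1); rewrite !mulrS mulr0n addr0 ?addrA.
have: X * (Y * Y * Z) = 0 by rewrite string_YYZ mulr0.
by rewrite !normalize string_YYZ mul0r add0r (ACl (3*1*4*2)).
Qed.

Lemma string_YZW : Y * Z * W = 0.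
Proof.
apply: (@R_torsion_free _ 5); rewrite !mulrS mulr0n addr0 ?addrA.
have: X * (Y * Z * Z + Y * Y * W) = 0 by rewrite string_YZZ mulr0.
rewrite !normalize Z3 addr0 (ACl ((1*6)*2*3*4*5*7*8)) /=.
by rewrite -[Y * Z * Z * X + _]mulrDl string_YZZ mul0r add0r.
Qed.

Lemma string_ZZW : Z * Z * W = 0.
Proof.
apply: (@R_torsion_free _ 5); rewrite !mulrS mulr0n addr0 ?addrA.
have: X * (Z * Z * Z) = 0 by rewrite Z3 mulr0.
by rewrite !normalize Z3 mul0r add0r.
Qed.

Lemma string_YWW : Y * W * W = 0.
Proof.
apply: (@R_torsion_free _ 1); rewrite !mulrS mulr0n addr0 ?addrA.
have: X * (Y * Z * W) = 0 by rewrite string_YZW mulr0.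
by rewrite !normalize string_YZW mul0r add0r string_ZZW addr0.
Qed.

Lemma string_ZWW : Z * W * W = 0.
Proof.
apply: (@R_torsion_free _ 3); rewrite !mulrS mulr0n addr0 ?addrA.
have: X * (Z * Z * W) = 0 by rewrite string_ZZW mulr0.
by rewrite !normalize string_ZZW mul0r add0r.
Qed.

End StringIdentities.

Section TruncatedExponential.

Local Open Scope ring_scope.

Variables (F : fieldType) (A : algType F).
Hypothesis two_neq0 : 2 != 0 :> F.
Implicit Types (t u : F) (P Q X Y Z W : A).

(** The exponential series without its terms of degree at least 3. *)
Definition exp2 X : A := 1 + X + 2^-1 *: (X * X).

Lemma exp2_scaled t X : exp2 (t *: X) = 1 + t *: X + (t ^+ 2 / 2) *: (X * X).
Proof.
by rewrite /exp2 -scalerAl -scalerAr !scalerA [t ^+ 2 / 2]mulrC expr2 mulrA.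
Qed.

Lemma half_double X : 2^-1 *: X + 2^-1 *: X = X.
Proof.
by rewrite -scalerDl -mulr2n -[_ *+ 2]mulr_natl divff // scale1r.
Qed.

(** The two sides differ by [(P P Q + P Q Q) / 2 + P P Q Q / 4]. *)
Lemma exp2D P Q : Q * P = P * Q ->
    P * P * Q + P * Q * Q = 0 -> P * P * Q * Q = 0 ->
  exp2 P * exp2 Q = exp2 (P + Q).
Proof.
move=> QP PPQ PPQQ; rewrite /exp2 !(mulrDl, mulrDr) !(mul1r, mulr1).
rewrite -!(scalerAl, scalerAr) !mulrA PPQQ !scaler0 addr0 QP.
rewrite !addrA (ACl (1*4*2*(7*5*3)*(8*6))) /= -scalerDr PPQ scaler0 addr0.
by rewrite -[P * P + _ + _]addrA !scalerDr half_double !addrA.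
Qed.

Section StringCommutator.

Variables X Y Z W : A.
Hypotheses (XY : X * Y = Y * X + Z) (XZ : X * Z = Z * X + (W + W)).
Hypotheses (ZY : Z * Y = Y * Z) (WY : W * Y = Y * W) (WZ : W * Z = Z * W).
Hypotheses (ZXX : Z * X * X + W * X + W * X = 0) (WXX : W * X * X = 0).
Hypotheses (YYZ : Y * Y * Z = 0) (YZZ : Y * Z * Z + Y * Y * W = 0).
Hypotheses (YZW : Y * Z * W = 0) (ZZW : Z * Z * W = 0).
Hypotheses (YWW : Y * W * W = 0) (ZWW : Z * W * W = 0).

(** Conjugation by the exponential of [X] is the exponential of [ad X], which
    maps [Y] to [Y + Z + W]. *)
Lemma exp2_mul_string : exp2 X * Y = (Y + Z + W) * exp2 X.
Proof.
have XXY: X * X * Y = Y * X * X + (Z * X + Z * X) + (W + W).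
  rewrite -mulrA XY mulrDr mulrA XY mulrDl XZ.
  by rewrite !addrA -[_ + Z * X + Z * X]addrA.
rewrite /exp2 !(mulrDl, mulrDr) mul1r !mulr1 -!(scalerAl, scalerAr) XXY XY.
rewrite !scalerDr !half_double !mulrA WXX scaler0 addr0.
have E: 2^-1 *: (Z * X * X) + W * X = 0.
  by rewrite -[W * X]half_double -!scalerDr addrA ZXX scaler0.
by rewrite !addrA [RHS](ACl ((1*2*4*3*5*7)*(6*8))) /= E addr0.
Qed.

(** The product [Y Z Z] need not vanish: only its sum with [Y Y W] does, and
    this is what allows to split off [exp2 Y]. *)
Lemma exp2_string_sum : exp2 (Y + Z + W) = exp2 Y * exp2 Z * exp2 W.
Proof.
rewrite -mulrA [exp2 Z * _]exp2D //; last first.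
- by rewrite ZZW mul0r.
- by rewrite ZZW ZWW addr0.
have YQQ: Y * (Z + W) * (Z + W) = Y * Z * Z.
  rewrite !(mulrDl, mulrDr) YZW YWW -[Y * W * Z]mulrA WZ mulrA YZW.
  by rewrite !addr0.
rewrite exp2D ?addrA //.
- by rewrite mulrDl mulrDr ZY WY.
- rewrite YQQ mulrDr YYZ add0r addrC; exact: YZZ.
by rewrite -!mulrA [Y * ((Z + W) * _)]mulrA YQQ !mulrA YYZ mul0r.
Qed.

Lemma exp2_string : exp2 X * exp2 Y = exp2 Y * exp2 Z * exp2 W * exp2 X.
Proof.
rewrite -exp2_string_sum; move: exp2_mul_string.
move: (exp2 X) (Y + Z + W) => E B EY.
rewrite /exp2 !(mulrDl, mulrDr) mul1r mulr1 -scalerAl -scalerAr mulrA EY.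
by rewrite -mulrA EY mulrA.
Qed.

End StringCommutator.

Lemma exp2_string_scaled t u X Y Z W :
    X * Y = Y * X + Z -> X * Z = Z * X + (W + W) ->
    Z * Y = Y * Z -> W * Y = Y * W -> W * Z = Z * W ->
    Z * X * X + W * X + W * X = 0 -> W * X * X = 0 ->
    Y * Y * Z = 0 -> Y * Z * Z + Y * Y * W = 0 -> Y * Z * W = 0 ->
    Z * Z * W = 0 -> Y * W * W = 0 -> Z * W * W = 0 ->
  exp2 (t *: X) * exp2 (u *: Y) =
    exp2 (u *: Y) * exp2 ((t * u) *: Z) * exp2 ((t ^+ 2 * u) *: W)
      * exp2 (t *: X).
Proof.
move=> XY XZ ZY WY WZ ZXX WXX YYZ YZZ YZW ZZW YWW ZWW.
have sM a b P Q : (a *: P) * (b *: Q) = (a * b) *: (P * Q).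
  by rewrite -scalerAl -scalerAr scalerA.
apply: exp2_string; rewrite !sM.
- by rewrite XY scalerDr [u * t]mulrC.
- by rewrite XZ !scalerDr; congr (_ *: _ + (_ *: _ + _ *: _)); ring.
- by rewrite ZY mulrC.
- by rewrite WY mulrC.
- by rewrite WZ mulrC.
- rewrite (_ : t * u * t * t = t ^+ 2 * u * t); last by ring.
  by rewrite -!scalerDr ZXX scaler0.
- by rewrite WXX scaler0.
- by rewrite YYZ scaler0.
- rewrite (_ : u * u * (t ^+ 2 * u) = u * (t * u) * (t * u)); last by ring.
  by rewrite -scalerDr YZZ scaler0.
- by rewrite YZW scaler0.
- by rewrite ZZW scaler0.
- by rewrite YWW scaler0.
- by rewrite ZWW scaler0.
Qed.

Lemma exp2_sumr t u X : X * X * X = 0 ->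
  exp2 (t *: X) * exp2 (u *: X) = exp2 ((t + u) *: X).
Proof.
move=> X3; have sM a b P Q : (a *: P) * (b *: Q) = (a * b) *: (P * Q).
  by rewrite -scalerAl -scalerAr scalerA.
by rewrite scalerDl exp2D // !sM ?X3 ?mul0r ?scaler0 ?addr0 // mulrC.
Qed.

Lemma exp2_comm X Y : X * Y = Y * X -> exp2 X * exp2 Y = exp2 Y * exp2 X.
Proof.
move=> XY; have comm1 P : P * X = X * P -> P * exp2 X = exp2 X * P.
  move=> PX; rewrite /exp2 !(mulrDl, mulrDr) mul1r mulr1 -scalerAl -scalerAr PX.
  by rewrite mulrA PX -!mulrA PX.
have EY : exp2 X * Y = Y * exp2 X by rewrite comm1.
move: (exp2 X) EY => E EY.
rewrite /exp2 !(mulrDl, mulrDr) mul1r mulr1 -scalerAl -scalerAr EY.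
by rewrite mulrA EY -!mulrA EY.
Qed.

End TruncatedExponential.

(** * Groups graded by a system of positive roots *)

Section GroupPreliminaries.

Local Open Scope group_scope.

Variable gT : finGroupType.
Implicit Types (A : {set gT}) (G H : {group gT}).

Lemma gen_closed_ind A (P : pred gT) :
    P 1 -> {in <<A>> &, forall g h, P g -> P h -> P (g * h)} ->
  {in A, forall g, P g} -> {in <<A>>, forall g, P g}.
Proof.
move=> P1 PM PA g; pose B := [set g in <<A>> | P g].
have gB: group_set B.
  apply/group_setP; split=> [|a b]; rewrite !inE ?group1 //.
  by case/andP=> Aa Pa /andP[Ab Pb]; rewrite groupM ?PM.
have sAB: <<A>> \subset Group gB.
  by rewrite gen_subG; apply/subsetP=> a Aa; rewrite inE mem_gen ?PA.
by move/(subsetP sAB); rewrite inE => /andP[].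
Qed.

Lemma abelian_prodM G (I : Type) (s : seq I) (F1 F2 : I -> gT) :
    abelian G -> (forall i, F1 i \in G) -> (forall i, F2 i \in G) ->
  \prod_(i <- s) (F1 i * F2 i) = \prod_(i <- s) F1 i * \prod_(i <- s) F2 i.
Proof.
move=> cGG G1 G2; elim: s => [|i s IHs]; first by rewrite !big_nil mulg1.
rewrite !big_cons {}IHs -!mulgA; congr (_ * _); rewrite !mulgA; congr (_ * _).
by apply: (centsP cGG); rewrite ?group_prod.
Qed.

End GroupPreliminaries.

Section RootGroup.

Local Open Scope group_scope.

Variables (p d : nat) (gT : finGroupType) (V : zmodType).
Variables (pos : seq V) (al : 'I_d -> V) (ht : V -> nat).
Variables (x : V -> 'F_p -> gT) (c : V -> gT -> 'F_p).

Definition root_filtration (k : nat) : {group gT} :=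
  <<[set g | has (fun r => (k <= ht r) && [exists t, g == x r t]) pos]>>%G.

Arguments root_filtration k : simpl never.

Local Notation G := root_filtration.
Local Notation U := (root_filtration 1).

Hypothesis p_prime : prime p.
Hypothesis al_pos : forall i, al i \in pos.
Hypothesis al_inj : injective al.
Hypothesis ht_al : forall i, ht (al i) = 1%N.
Hypothesis ht_gt0 : {in pos, forall r, 0 < ht r}.
Hypothesis htD : forall r s,
  r \in pos -> s \in pos -> (r + s)%R \in pos -> ht (r + s)%R = (ht r + ht s)%N.
Hypothesis pos_decomp : forall r,
  r \in pos -> exists i, r = al i \/ (r - al i)%R \in pos.
Hypothesis xD : forall r t u, r \in pos -> x r (t + u)%R = x r t * x r u.
Hypothesis xC : forall r s t u, r \in pos -> s \in pos ->
  (r + s)%R \notin pos ->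
  commute (x r t) (x s u).
(** Chevalley's commutator relation, modulo root elements of height greater
    than that of [r + s]. *)
Hypothesis xR : forall r s, r \in pos -> s \in pos -> (r + s)%R \in pos ->
  exists2 n : 'F_p, n != 0%R & forall t u,
    exists2 z, z \in G (ht (r + s)%R).+1
             & [~ x r t, x s u] = x (r + s)%R (n * t * u)%R * z.
(** [c s] is a coordinate at the root [s]; it is meaningful on the elements
    of height at least [ht s] only. *)
Hypothesis cM : forall s, s \in pos ->
  {in G (ht s) &, forall g h, c s (g * h) = (c s g + c s h)%R}.
Hypothesis cx : forall r s t, r \in pos -> s \in pos -> ht s <= ht r ->
  c s (x r t) = if r == s then t else 0%R.

Lemma mem_root_filtration r t k : r \in pos -> k <= ht r -> x r t \in G k.
Proof.
move=> pos_r le_k; apply: mem_gen; rewrite inE; apply/hasP; exists r => //.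
by rewrite le_k; apply/existsP; exists t.
Qed.

Lemma root_filtration_ind k (P : pred gT) :
    P 1 -> {in G k &, forall g h, P g -> P h -> P (g * h)} ->
    (forall r t, r \in pos -> k <= ht r -> P (x r t)) ->
  {in G k, forall g, P g}.
Proof.
move=> P1 PM Px; apply: gen_closed_ind => // g; rewrite inE => /hasP[r pos_r].
by case/andP=> le_k /existsP[t /eqP->]; apply: Px.
Qed.

Lemma root_filtrationS k l : k <= l -> G l \subset G k.
Proof.
move=> le_kl; rewrite gen_subG; apply/subsetP=> g;
  rewrite inE => /hasP[r pos_r].
case/andP=> le_l /existsP[t /eqP->]; apply: mem_root_filtration => //.
exact: leq_trans le_l.
Qed.

Lemma x0 r : r \in pos -> x r 0%R = 1.
Proof.
by move=> pos_r; apply: (mulgI (x r 0%R)); rewrite -xD // addr0 mulg1.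
Qed.

Lemma comm_x r s t u : r \in pos -> s \in pos ->
  [~ x r t, x s u] \in G (ht r + ht s).
Proof.
move=> pos_r pos_s; have [pos_rs|npos_rs] := boolP ((r + s)%R \in pos).
  have [n _ /(_ t u)[z Gz ->]] := xR pos_r pos_s pos_rs.
  rewrite -htD // groupM ?mem_root_filtration //.
  exact: subsetP (root_filtrationS (leqnSn _)) _ Gz.
by have /commgP/eqP-> := xC t u pos_r pos_s npos_rs.
Qed.

Lemma root_filtration_norm k : U \subset 'N(G k).
Proof.
apply/subsetP=> w Uw; apply: (@root_filtration_ind 1 (mem 'N(G k))
  _ _ _ w Uw)
  => /= [|g h _ _|s u pos_s _].
- exact: group1.
- exact: groupM.
rewrite inE -genJ gen_subG; apply/subsetP=> y /imsetP[g].
rewrite inE => /hasP[r pos_r /andP[le_k /existsP[t /eqP->]]] {y}->.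
rewrite conjg_mulR groupM ?mem_root_filtration //.
by apply: subsetP (comm_x t u pos_r pos_s);
  apply/root_filtrationS/leq_trans/leq_addr.
Qed.

Lemma root_filtration_sub k : 0 < k -> G k \subset U.
Proof. exact: root_filtrationS. Qed.

Lemma conj_root_filtration k g h : h \in U -> g \in G k -> g ^ h \in G k.
Proof.
by move=> Uh Gg; rewrite memJ_norm // (subsetP (root_filtration_norm k)).
Qed.

Lemma comm_root_filtration k l g h :
  0 < k -> 0 < l -> g \in G k -> h \in G l -> [~ g, h] \in G (k + l).
Proof.
move=> k_gt0 l_gt0 Gg Gh.
have sU := subsetP (root_filtration_sub _).
apply: (@root_filtration_ind _ [pred h | [~ g, h] \in G (k + l)]
  _ _ _ h Gh)
  => /= [|h1 h2 G1 G2 R1 R2|s u pos_s le_l].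
- by rewrite commg1 group1.
- by rewrite commgMJ groupM // conj_root_filtration // (sU l).
apply: (@root_filtration_ind _ [pred g | [~ g, x s u] \in G (k + l)]
  _ _ _ g Gg)
  => /= [|g1 g2 G1 G2 R1 R2|r t pos_r le_k].
- by rewrite comm1g group1.
- by rewrite commMgJ groupM // conj_root_filtration // (sU k).
apply: subsetP (comm_x t u pos_r pos_s).
by apply: root_filtrationS; apply: leq_add.
Qed.

Lemma root_filtration_top : exists k, G k :=: 1.
Proof.
exists (\max_(r <- pos) ht r).+1; apply/trivgP; rewrite gen_subG.
apply/subsetP=> g; rewrite inE => /hasP[r pos_r /andP[]].
by rewrite ltnNge (leq_bigmax_seq _ pos_r).
Qed.

Lemma lcn_sub_root_filtration k : 'L_k.+1(U) \subset G k.+1.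
Proof.
elim: k => [|k IHk]; first by rewrite lcn1.
rewrite lcnSn gen_subG; apply/subsetP=> _ /imset2P[g h Lg Uh ->].
by rewrite -addn1 comm_root_filtration // (subsetP IHk).
Qed.

(** A root [r] of height [k + 2] is [s + al i] with [s] of height [k + 1], and
    each [x r t] is a commutator of [x s] and [x (al i)] modulo [G k.+3]. *)
Lemma root_filtration_lcn_step k : G k.+1 \subset 'L_k.+1(U) <*> G k.+2.
Proof.
elim: k => [|k IHk]; first by rewrite lcn1 joing_subl.
apply/subsetP=> w Gw.
apply: (@root_filtration_ind _ (mem ('L_k.+2(U) <*> G k.+3)) _ _ _ w Gw)
  => /= [|g h _ _|r t pos_r].
- exact: group1.
- exact: groupM.
rewrite leq_eqVlt => /predU1P[ht_r|]; last first.
  by move=> lt_r; rewrite mem_gen // inE mem_root_filtration ?orbT.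
have [i [Dr|pos_s]] := pos_decomp pos_r; first by rewrite Dr ht_al in ht_r.
set s := (r - al i)%R in pos_s; have Dr: (s + al i)%R = r by rewrite subrK.
have ht_s: ht s = k.+1.
  have := htD pos_s (al_pos i); rewrite Dr ht_al addn1 -ht_r.
  by case/(_ pos_r).
have pos_si: (s + al i)%R \in pos by rewrite Dr.
have [n n_nz /(_ (t / n)%R 1%R)[z]] := xR pos_s (al_pos i) pos_si.
rewrite Dr -ht_r mulr1 mulrCA divff // mulr1 => Gz.
move/esym/(canRL (mulgK z))->; rewrite groupMr; last first.
  by rewrite groupV mem_gen // inE Gz orbT.
have: x s (t / n)%R \in 'L_k.+1(U) * G k.+2.
  rewrite -norm_joinEl; last first.
    exact: subset_trans (lcn_sub _ _) (root_filtration_norm _).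
  by rewrite (subsetP IHk) // mem_root_filtration ?ht_s.
have Ux: x (al i) 1%R \in U by rewrite mem_root_filtration ?ht_al.
case/mulsgP=> g h Lg Gh ->; rewrite commMgJ groupM // mem_gen // inE.
- apply/orP; left; rewrite memJ_norm; first by rewrite lcnSn mem_commg.
  apply: (subsetP (lcn_norm k.+2 U)).
  exact: subsetP (root_filtration_sub _) _ Gh.
- by rewrite -[k.+3]addn1 comm_root_filtration ?orbT.
Qed.

Lemma root_filtrationE k : G k.+1 :=: 'L_k.+1(U).
Proof.
apply/eqP; rewrite eqEsubset lcn_sub_root_filtration andbT.
have [l Gl1] := root_filtration_top.
suff sub j : G k.+1 \subset 'L_k.+1(U) <*> G (k.+1 + j).
  have G1: G (k.+1 + l) :=: 1.
    by apply/trivgP; rewrite -Gl1 root_filtrationS ?leq_addl.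
  by have := sub l; rewrite G1 joingG1.
elim: j => [|j IHj]; first by rewrite addn0 joing_subr.
apply: subset_trans IHj _; rewrite join_subG joing_subl /=.
apply: subset_trans (root_filtration_lcn_step (k + j)) _.
rewrite addnS join_subG joing_subr andbT.
by apply: subset_trans (joing_subl _ _); rewrite lcn_sub_leq // ltnS leq_addr.
Qed.

Lemma root_filtration2 : [~: U, U] = G 2.
Proof. by rewrite (root_filtrationE 1) lcnSn lcn1. Qed.

Lemma c1 s : s \in pos -> c s 1 = 0%R.
Proof.
move=> pos_s; apply: (addrI (c s 1)).
by rewrite -cM ?group1 // mulg1 addr0.
Qed.

Lemma c_above s g : s \in pos -> g \in G (ht s).+1 -> c s g = 0%R.
Proof.
move=> pos_s Gg; apply/eqP.
apply: (@root_filtration_ind _ [pred g | c s g == 0%R] _ _ _ g Gg) => /=.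
- by rewrite c1.
- move=> a b /(subsetP (root_filtrationS (leqnSn _))) Ga.
  move=> /(subsetP (root_filtrationS (leqnSn _))) Gb /eqP ca /eqP cb.
  by rewrite cM // ca cb addr0.
move=> r t pos_r lt_s; rewrite cx //; last exact: ltnW.
by have [Drs|//] := eqVneq r s; rewrite Drs ltnn in lt_s.
Qed.

Definition chi i g : 'F_p := c (al i) g.

Lemma chiM i : {in U &, forall g h, chi i (g * h) = (chi i g + chi i h)%R}.
Proof. by have := cM (al_pos i); rewrite ht_al. Qed.

Lemma chi_x i r t : r \in pos -> chi i (x r t) = if r == al i then t else 0%R.
Proof. by move=> pos_r; rewrite /chi cx ?ht_al ?ht_gt0. Qed.

Lemma chi_derived i g : g \in [~: U, U] -> chi i g = 0%R.
Proof. by rewrite root_filtration2 => Gg; apply: c_above; rewrite ?ht_al. Qed.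

Lemma mem_x_al i t : x (al i) t \in U.
Proof. by rewrite mem_root_filtration ?ht_al. Qed.

Lemma chiX i g n : g \in U -> chi i (g ^+ n) = (chi i g *+ n)%R.
Proof.
move=> Ug; elim: n => [|n IHn]; first by rewrite /chi c1.
by rewrite expgS chiM ?groupX // IHn mulrS.
Qed.

Definition simple_product (v : {ffun 'I_d -> 'F_p}) : gT :=
  \prod_i x (al i) (v i).

Lemma simple_product_mem v : simple_product v \in U.
Proof. by apply: group_prod => i _; apply: mem_x_al. Qed.

Lemma chi_simple_product i v : chi i (simple_product v) = v i.
Proof.
have: chi i (simple_product v) = (\sum_j chi i (x (al j) (v j)))%R.
  rewrite /simple_product.
  elim: (index_enum _) => [|j s IHs]; first by rewrite !big_nil /chi c1.
  rewrite !big_cons chiM ?mem_x_al ?IHs //.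
  by apply: group_prod => k _; apply: mem_x_al.
move=> ->; rewrite (bigD1 i) //= chi_x // eqxx big1 ?addr0 // => j ne_ji.
by rewrite chi_x // (inj_eq al_inj) (negPf ne_ji).
Qed.

Lemma U_norm_derived : U \subset 'N([~: U, U]).
Proof. exact: commg_normr. Qed.

(** Root elements of height at least 2 lie in the derived subgroup, and the
    others multiply independently modulo it. *)
Lemma coset_simple_product g : g \in U ->
  coset [~: U, U] g = coset [~: U, U] (simple_product [ffun i => chi i g]).
Proof.
have NU := subsetP U_norm_derived.
have cosM : {in U &, {morph coset [~: U, U] : a b / a * b}}.
  by move=> a b Ua Ub; apply: morphM; apply: NU.
have cos1 : coset [~: U, U] 1 = 1 by apply: morph1.
have coset_prod h : coset [~: U, U] (simple_product [ffun i => chi i h])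
    = \prod_i coset [~: U, U] (x (al i) (chi i h)).
  rewrite /simple_product -(morph_prod (coset_morphism [~: U, U])) => [|i _].
    by congr (coset _ _); apply: eq_bigr => i _; rewrite ffunE.
  exact: NU (mem_x_al _ _).
move=> Ug; rewrite coset_prod.
pose P := [pred g | coset [~: U, U] g
                     == \prod_i coset [~: U, U] (x (al i) (chi i g))].
apply/eqP; apply: (@root_filtration_ind 1 P _ _ _ g Ug) => /=.
- by rewrite cos1 big1 // => i _; rewrite /chi c1 // x0 // cos1.
- move=> a b Ua Ub /eqP Da /eqP Db; rewrite cosM // Da Db.
  have abQ: abelian (U / [~: U, U]) by apply: der_abelian 0 _.
  rewrite -(abelian_prodM _ abQ) => [|i|i]; last first.
  + by rewrite mem_quotient ?mem_x_al.
  + by rewrite mem_quotient ?mem_x_al.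
  by apply/eqP/eq_bigr => i _; rewrite chiM // xD // cosM ?mem_x_al.
move=> r t pos_r _;
have [/existsP[i /eqP Dr]|/existsPn nal_r] := boolP [exists i, r == al i].
  rewrite Dr; apply/eqP.
  transitivity (\prod_(j | j == i) coset [~: U, U] (x (al j) t)).
    by rewrite big_pred1_eq.
  rewrite big_mkcond; apply: eq_bigr => j _.
  rewrite chi_x // (inj_eq al_inj) [i == j]eq_sym.
  by case: eqP => // _; rewrite x0 ?cos1.
have ht_r: 1 < ht r.
  have [i [Dr|pos_s]] := pos_decomp pos_r.
    by have := nal_r i; rewrite Dr eqxx.
  have := htD pos_s (al_pos i); rewrite subrK => ->//.
  by rewrite ht_al addn1 ltnS ht_gt0.
rewrite coset_id; last by rewrite root_filtration2 mem_root_filtration.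
by rewrite big1 // => i _; rewrite chi_x // (negPf (nal_r i)) x0 // cos1.
Qed.

(** The preimage in [U] of the subspace of [U / U'] that is spanned by the
    simple roots in [S]. *)
Definition support_set (S : {set 'I_d}) : {set gT} :=
  [set g in U | [forall i, (i \notin S) ==> (chi i g == 0%R)]].

Implicit Types S : {set 'I_d}.

Lemma support_setP S g :
  reflect (g \in U /\ forall i, i \notin S -> chi i g = 0%R)
          (g \in support_set S).
Proof.
rewrite inE; apply: (iffP andP) => [[Ug /forallP Sg]|[Ug Sg]]; split=> //.
  by move=> i nSi; apply/eqP; have := Sg i; rewrite nSi.
by apply/forallP=> i; apply/implyP=> nSi; rewrite Sg.
Qed.

Lemma support_set_group S : group_set (support_set S).
Proof.
apply/group_setP; split=> [|g h /support_setP[Ug Sg] /support_setP[Uh Sh]].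
  by apply/support_setP; split=> // i _; rewrite /chi c1.
apply/support_setP; split=> [|i nSi]; first exact: groupM.
by rewrite chiM // Sg // Sh // addr0.
Qed.

Definition support_group S := Group (support_set_group S).

Lemma support_group_sub S : support_group S \subset U.
Proof. by apply/subsetP=> g /support_setP[]. Qed.

Lemma derived_sub_support_group S : [~: U, U] \subset support_group S.
Proof.
apply/subsetP=> g U'g; apply/support_setP; split=> [|i _].
  exact: subsetP (der_sub 1 _) _ U'g.
exact: chi_derived.
Qed.

Lemma support_group0 : support_group set0 :=: [~: U, U].
Proof.
apply/eqP; rewrite eqEsubset derived_sub_support_group andbT.
apply/subsetP=> g /support_setP[Ug Sg].
apply: coset_idr; first exact: subsetP U_norm_derived _ Ug.
rewrite coset_simple_product //;
  suff -> : simple_product [ffun i => chi i g] = 1.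
  exact: morph1.
by apply: big1 => i _; rewrite ffunE Sg ?inE // x0.
Qed.

Lemma support_groupT : support_group setT :=: U.
Proof.
apply/eqP; rewrite eqEsubset support_group_sub.
by apply/subsetP=> g Ug; apply/support_setP; split=> // i; rewrite inE.
Qed.

(** [U / U'] has the images of the [x (al i) 1] as a basis: they generate it by
    [coset_simple_product], and are independent by [chi_simple_product]. *)
Lemma card_support_quotient S : #|support_group S / [~: U, U]| = (p ^ #|S|)%N.
Proof.
pose f v := coset [~: U, U] (simple_product v).
have -> : support_group S / [~: U, U]
    = f @: [set v in pffun_on 0%R (mem S) predT].
  apply/setP=> y; apply/idP/imsetP=> [/morphimP[g _ /support_setP[Ug Sg] ->]|].
    exists [ffun i => chi i g]; last exact: coset_simple_product.
    rewrite inE; apply/pffun_onP; split=> //; apply/supportP=> i nSi.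
    by rewrite ffunE Sg.
  case=> v; rewrite inE => /pffun_onP[/supportP Sv _] ->.
  apply: mem_quotient; apply/support_setP; split=> [|i nSi].
    exact: simple_product_mem.
  by rewrite chi_simple_product Sv.
rewrite card_in_imset => [|v w _ _].
  by rewrite cardsE card_pffun_on card_Fp.
have NU u := subsetP U_norm_derived _ (simple_product_mem u).
move/(rcoset_kercosetP (NU v) (NU w))/rcosetP=> [g U'g Dv].
have Ug : g \in U by apply: subsetP (der_sub 1 _) _ U'g.
apply/ffunP=> i; rewrite -!chi_simple_product Dv chiM ?simple_product_mem //.
by rewrite chi_derived // add0r.
Qed.

Lemma U_quotient_abelem : p.-abelem (U / [~: U, U]).
Proof.
have abQ: abelian (U / [~: U, U]) by apply: der_abelian 0 _.
rewrite abelemE // abQ; apply/exponentP=> _ /morphimP[g Ng Ug ->].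
rewrite -morphX //; apply: coset_id.
rewrite -support_group0; apply/support_setP; split=> [|i _];
  first exact: groupX.
by rewrite chiX // (mulrn_pchar (pchar_Fp p_prime)).
Qed.

(** Whether [x (al i)] acts nontrivially by commutators from the layer [k] of
    the lower central series to the next one; see [centralizes_modP]. *)
Definition acts_at (k : nat) (i : 'I_d) : bool :=
  has (fun r => (ht r == k.+1) && ((r - al i)%R \in pos)) pos.

Definition centralizes_mod (k : nat) (g : gT) : Prop :=
  {in G k, forall h, [~ g, h] \in G k.+2}.

Lemma centralizes_modM k g h : 0 < k -> g \in U -> h \in U ->
  centralizes_mod k g -> centralizes_mod k h -> centralizes_mod k (g * h).
Proof.
move=> k_gt0 Ug Uh Cg Ch y Gy.
by rewrite commMgJ groupM ?Ch // conj_root_filtration ?Cg.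
Qed.

Lemma centralizes_mod_x k i t :
  0 < k -> ~~ acts_at k i -> centralizes_mod k (x (al i) t).
Proof.
move=> k_gt0 nact y Gy.
apply: (@root_filtration_ind _ [pred y | [~ x (al i) t, y] \in G k.+2]
  _ _ _ y Gy)
  => /=.
- by rewrite commg1 group1.
- move=> a b Ga Gb Ca Cb; rewrite commgMJ groupM // conj_root_filtration //.
  exact: subsetP (root_filtration_sub _) _ Gb.
move=> r u pos_r; rewrite leq_eqVlt => /predU1P[ht_r|lt_r]; last first.
  apply: subsetP (comm_x _ _ (al_pos i) pos_r).
  by apply: root_filtrationS; rewrite ht_al add1n ltnS.
suff npos : (al i + r)%R \notin pos.
  by have /commgP/eqP-> := xC t u (al_pos i) pos_r npos.
apply: contra nact => pos_ir; apply/hasP; exists (al i + r)%R => //.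
by rewrite htD // ht_al -ht_r eqxx addrC addKr.
Qed.

(** Let [r = al i + s] have height [k + 1].  The coordinate at [r] of
    [[g, x s 1]] is additive in [g]; it vanishes on the root elements other than
    those of [al i], because only [al i] gives [r] when added to [s].  So it is
    a nonzero multiple of [chi i g]. *)
Lemma centralizes_modP k g : 0 < k -> g \in U ->
  (centralizes_mod k g <-> forall i, acts_at k i -> chi i g = 0%R).
Proof.
move=> k_gt0 Ug; split=> [Cg i /hasP[r pos_r /andP[/eqP ht_r pos_s]]|g0].
  set s := (r - al i)%R in pos_s;
    have Dr: (al i + s)%R = r by rewrite addrC subrK.
  have ht_s: ht s = k.
    have := htD (al_pos i) pos_s; rewrite Dr ht_al ht_r add1n => /(_ pos_r).
    by case.
  have Us: x s 1%R \in U by rewrite mem_root_filtration ?ht_gt0.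
  have Gs: x s 1%R \in G k by rewrite mem_root_filtration ?ht_s.
  have pos_is: (al i + s)%R \in pos by rewrite Dr.
  have [n n_nz Dn] := xR (al_pos i) pos_s pos_is.
  suff: (c r [~ g, x s 1] = n * chi i g)%R.
    rewrite c_above ?ht_r //; last exact: Cg.
    by move/esym/eqP; rewrite mulf_eq0 (negPf n_nz) => /eqP.
  pose P := [pred g | (c r [~ g, x s 1] == n * chi i g)%R].
  apply/eqP; apply: (@root_filtration_ind 1 P _ _ _ g Ug) => /=.
  - by rewrite comm1g c1 // /chi c1 // mulr0.
  - move=> a b Ua Ub /eqP Da /eqP Db.
    have G1 u : u \in U -> [~ u, x s 1%R] \in G (ht r).
      by move=> Uu; rewrite ht_r -add1n comm_root_filtration.
    have G2 : [~ [~ a, x s 1%R], b] \in G (ht r).+1.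
      by rewrite -addn1 comm_root_filtration ?G1 // ht_r.
    have G2' := subsetP (root_filtrationS (leqnSn _)) _ G2.
    have [Ga Gb] := (G1 a Ua, G1 b Ub).
    rewrite commMgJ conjg_mulR cM ?(groupM Ga G2') // cM // (c_above _ G2) //.
    by rewrite addr0 Da Db chiM // mulrDr.
  move=> q t pos_q _; rewrite chi_x //.
  have [pos_qs|npos_qs] := boolP ((q + s)%R \in pos); last first.
    have /commgP/eqP-> := xC t 1%R pos_q pos_s npos_qs; rewrite c1 //.
    case: (q =P al i) => [Dq|_]; last by rewrite mulr0.
    by rewrite Dq pos_is in npos_qs.
  have le_r : ht r <= ht (q + s)%R.
    by rewrite htD // ht_r ht_s -add1n leq_add2r ht_gt0.
  have xG u : x (q + s)%R u \in G (ht r) by rewrite mem_root_filtration.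
  have zG z : z \in G (ht (q + s)%R).+1 -> z \in G (ht r).+1.
    by apply/subsetP/root_filtrationS.
  have zG' z : z \in G (ht r).+1 -> z \in G (ht r).
    exact/subsetP/root_filtrationS/leqnSn.
  case: (q =P al i) => [Dq|ne_q].
    have [z /[dup] Gz] := Dn t 1%R; rewrite -Dq => /zG Gz' ->.
    rewrite cM // ?zG' // (c_above _ Gz') // addr0 cx // Dq Dr eqxx.
    by rewrite mulr1.
  have [n' _ /(_ t 1%R)[z /zG Gz ->]] := xR pos_q pos_s pos_qs.
  rewrite cM // ?zG' // (c_above _ Gz) // addr0 cx // -Dr (inj_eq (addIr s)).
  by rewrite mulr0; case: (q =P al i).
have Uprod := simple_product_mem [ffun i => chi i g].
have NU := subsetP U_norm_derived _ _.
have /rcoset_kercosetP := coset_simple_product Ug.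
case/(_ (NU _ Ug) (NU _ Uprod))/rcosetP=> u U'u ->.
have Uu : u \in U by apply: subsetP (der_sub 1 _) _ U'u.
apply: centralizes_modM => // [y Gy|].
  by rewrite -[k.+2]add2n comm_root_filtration // -root_filtration2.
suff [//] : simple_product [ffun i => chi i g] \in U
            /\ centralizes_mod k (simple_product [ffun i => chi i g]).
pose P h := h \in U /\ centralizes_mod k h.
apply: (big_ind P) => [|a b [Ua Ca] [Ub Cb]|i _].
- by split=> [|y Gy]; rewrite ?comm1g group1.
- by split; [apply: groupM | apply: centralizes_modM].
split; first exact: mem_x_al.
rewrite ffunE; have [act_i|nact] := boolP (acts_at k i).
  by rewrite g0 // x0 // => y Gy; rewrite comm1g group1.
exact: centralizes_mod_x.
Qed.

Lemma autm_root_filtration k f (AutUf : f \in Aut U) :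
  autm AutUf @* G k.+1 = G k.+1.
Proof.
have /charP[_ fixL] := lcn_char k.+1 U.
by rewrite (root_filtrationE k) fixL ?injm_autm ?im_autm.
Qed.

Lemma autm_centralizes_mod k f g : 0 < k -> f \in Aut U -> g \in U ->
  centralizes_mod k g -> centralizes_mod k (f g).
Proof.
case: k => // k _ AutUf Ug Cg y; rewrite -(autm_root_filtration k AutUf).
case/morphimP=> h Uh Gh ->.
rewrite -[f g]/(autm AutUf g) -morphR // -(autm_root_filtration k.+2 AutUf).
by apply: mem_morphim; [rewrite groupR | exact: Cg].
Qed.

(** By [centralizes_modP], the elements of [U] supported on a definable set are
    those that centralize, in the sense of [centralizes_mod], the layers that
    [K] selects; an automorphism of [U] preserves this property. *)
Definition definable (S : {set 'I_d}) : Prop :=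
  exists K : pred nat, forall i,
    i \in S <-> forall k, 0 < k -> K k -> ~~ acts_at k i.

Lemma support_group_Aut_invariant S : S = set0 \/ definable S ->
  Aut_invariant (support_group S / [~: U, U])%G.
Proof.
move=> defS f g AutUf Ug Wg.
have Sg : g \in support_group S.
  have NU := subsetP U_norm_derived.
  case/morphimP: Wg
    => h Nh Sh /(rcoset_kercosetP (NU _ Ug) Nh)/rcosetP[u U'u ->].
  by rewrite groupM // (subsetP (derived_sub_support_group _)).
apply: mem_quotient; case: defS => [S0 | [K defS]].
  move: Sg; rewrite S0 support_group0 root_filtration2 => Gg.
  rewrite -[f g]/(autm AutUf g) -(autm_root_filtration 1 AutUf).
  exact: mem_morphim.
have Ufg : f g \in U by rewrite -[f g]/(autm AutUf g) Aut_closed.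
apply/support_setP; split=> // i nSi.
apply/eqP; apply: contraNT nSi => nz_i; apply/defS=> k k_gt0 Kk.
have Cg : centralizes_mod k g.
  apply/centralizes_modP=> // j act_j; have [_ -> //] := support_setP _ _ Sg.
  by apply/negP=> /defS/(_ k k_gt0 Kk); rewrite act_j.
apply: contra nz_i => act_i; apply/eqP; move: act_i; move: i;
  apply/centralizes_modP=> //.
exact: autm_centralizes_mod.
Qed.

Lemma card_support_factor S S' : S' \subset S ->
  factor_dim p (support_group S / [~: U, U])%G (support_group S' / [~: U, U])%G
    = #|S| - #|S'|.
Proof.
move=> sSS';
have sW : support_group S' / [~: U, U] \subset support_group S / [~: U, U].
  apply: quotientS; apply/subsetP=> g /support_setP[Ug Sg].
  apply/support_setP; split=> // i nSi; apply: Sg.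
  by apply: contra nSi; apply: subsetP sSS' i.
have nW : support_group S' / [~: U, U] <| support_group S / [~: U, U].
  rewrite /normal sW (sub_abelian_norm _ sW) //.
  apply: abelianS (quotientS _ (support_group_sub S)) _.
  exact: abelem_abelian U_quotient_abelem.
rewrite /factor_dim card_quotient ?normal_norm // -divgS //.
rewrite !card_support_quotient -expnB ?prime_gt0 ?subset_leq_card //.
by rewrite pfactorK.
Qed.

Theorem root_group_series m (S : nat -> {set 'I_d}) :
    S 0 = setT -> S m = set0 ->
    (forall i, i < m -> S i.+1 \proper S i) ->
    (forall i, i <= m -> S i = set0 \/ definable (S i)) ->
  p.-abelem (U / [~: U, U]) /\
  exists W : nat -> {group coset_of [~: U, U]},
    [/\ [/\ W 0 = (U / [~: U, U])%G, W m = 1%G,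
            forall i, i < m -> W i.+1 \proper W i
          & forall i, i <= m -> Aut_invariant (W i)]
      & forall i, i < m -> factor_dim p (W i) (W i.+1) = #|S i| - #|S i.+1|].
Proof.
move=> S0 Sm propS defS; split; first exact: U_quotient_abelem.
exists (fun i => support_group (S i) / [~: U, U])%G; split=> [|i lt_im];
  last first.
  by apply: card_support_factor; apply/proper_sub/propS.
split=> [||i lt_im|i le_im].
- by rewrite S0 (group_inj support_groupT).
- rewrite Sm (group_inj (support_group0 : _ = gval [~: U, U]%G)).
  by apply/group_inj/trivg_quotient.
- rewrite properEcard !card_support_quotient ltn_exp2l ?prime_gt1 //.
  rewrite proper_card ?propS // andbT.
  apply: quotientS; apply/subsetP=> g /support_setP[Ug Sg].
  apply/support_setP; split=> // j nSj; apply: Sg.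
  by apply: contra nSj; apply/subsetP/proper_sub/propS.
- by apply: support_group_Aut_invariant; apply: defS.
Qed.

End RootGroup.

(** * The unipotent matrices *)

Section UnipotentMatrices.

Local Open Scope ring_scope.

Variables (T : classical_type) (d : nat).
Hypotheses (d_gt0 : (0 < d)%N) (d_gt1 : T = TypeD -> (1 < d)%N).
Variables (p n : nat).
Hypotheses (p_prime : prime p) (p_ge3 : (2 < p)%N).

Local Opaque roots pos_roots.

Local Notation V := 'rV[int]_(ambient_dim T d).
Local Notation Phi := (roots T d).
Local Notation Pos := (pos_roots T d).
Implicit Types r s : V.

Variables (a : V -> 'M[int]_n.+1) (wt : 'I_n.+1 -> int).
Hypothesis a_cube : forall r, r \in Phi -> a r *m (a r *m a r) = 0.
Hypothesis a_br : forall r s, r \in Phi -> s \in Phi -> r + s \in Phi ->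
  exists2 c : int, `|c|%N = (s - r \in Phi).+1
                 & a r *m a s = a s *m a r + a (r + s) *~ c.
Hypothesis a_comm : forall r s, r \in Phi -> s \in Phi -> r + s != 0 ->
  r + s \notin Phi -> a r *m a s = a s *m a r.
Hypothesis a_graded : forall r i j, r \in Phi -> a r i j != 0 ->
  wt i = wt j + height2 r.
Hypothesis a_detect : forall s, s \in Pos ->
  exists i, exists j, exists k : int,
    [/\ wt i = height2 s, wt j = 0, (0 < `|k| < 3)%N
      & {in Pos, forall r, a r i j = if r == s then k else 0}].

Lemma intr_Fp_neq0 (k : int) : (0 < `|k| < 3)%N -> k%:~R != 0 :> 'F_p.
Proof.
case/andP=> k_gt0 k_lt3; rewrite -(dvdz_pcharf (pchar_Fp p_prime)).
by apply/negP=> /(dvdn_leq k_gt0); rewrite leqNgt (leq_trans k_lt3).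
Qed.

Lemma two_Fp_neq0 : 2 != 0 :> 'F_p.
Proof. exact: (@intr_Fp_neq0 2). Qed.

Let redp : 'M[int]_n.+1 -> 'M['F_p]_n.+1 := map_mx intr.

Definition unipotent_mx r (t : 'F_p) : 'M['F_p]_n.+1 := exp2 (t *: redp (a r)).

Local Notation X := unipotent_mx.

Lemma redpM A B : redp (A *m B) = redp A * redp B.
Proof. exact: map_mxM. Qed.

Lemma redpD A B : redp (A + B) = redp A + redp B.
Proof. exact: map_mxD. Qed.

Lemma redpMz A c : redp (A *~ c) = c%:~R *: redp A.
Proof. by rewrite /redp raddfMz /= scaler_int. Qed.

Lemma unipotent_mxE r t :
  X r t = 1 + t *: redp (a r) + (t ^+ 2 / 2) *: (redp (a r) * redp (a r)).
Proof. exact: exp2_scaled. Qed.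

Lemma unipotent_mxD r t u : r \in Phi -> X r (t + u) = X r t * X r u.
Proof.
move=> Phi_r; rewrite /X exp2_sumr //; first exact: two_Fp_neq0.
by rewrite -mulrA -!redpM a_cube // /redp map_mx0.
Qed.

Lemma unipotent_mx0 r : X r 0 = 1.
Proof. by rewrite /X scale0r /exp2 mul0r scaler0 !addr0. Qed.

Lemma pos_root_sum_neq0 r s : r \in Pos -> s \in Pos -> r + s != 0.
Proof.
move=> pos_r pos_s; apply: contraTneq (pos_r) => rs0; apply/negP=> _.
have [] := pos_root_height d_gt0 d_gt1 pos_r.
have [] := pos_root_height d_gt0 d_gt1 pos_s.
have : height2 (r + s) = 0.
  by rewrite rs0 /height2 big1 // => i _; rewrite mxE mulr0.
rewrite height2D; lia.
Qed.

Lemma pos_rootDE r s : r \in Pos -> s \in Pos ->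
  (r + s \in Pos) = (r + s \in Phi).
Proof.
move=> pos_r pos_s; apply/idP/idP; first exact: pos_rootW.
exact: pos_root_sum.
Qed.

Lemma unipotent_mxC r s t u : r \in Pos -> s \in Pos -> r + s \notin Phi ->
  X r t * X s u = X s u * X r t.
Proof.
move=> pos_r pos_s out; apply: exp2_comm; rewrite -!scalerAl -!scalerAr.
have ac := a_comm (pos_rootW pos_r) (pos_rootW pos_s).
rewrite -!redpM (ac (pos_root_sum_neq0 pos_r pos_s) out).
by rewrite !scalerA mulrC.
Qed.

Lemma int_mx_torsion_free (A : 'M[int]_n.+1) k : A *+ k.+1 = 0 -> A = 0.
Proof.
move=> /matrixP A0; apply/matrixP=> i j; have := A0 i j.
by rewrite mulmxnE !mxE => /eqP; rewrite mulrn_eq0 => /eqP.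
Qed.

(** The last element [2 * r + s] of the string gives the extra factor.  The
    identities along the string are proved for integral matrices, where integer
    multiples can be cancelled, and then reduced modulo [p]. *)
Lemma unipotent_mx_string r s :
    r \in Pos -> s \in Pos -> r + s \in Phi -> s + (r + s) \notin Phi ->
  exists2 c : 'F_p, c != 0 & forall t u, exists w : 'F_p,
    X r t * X s u = X s u * X (r + s) (c * t * u)
      * (if r + (r + s) \in Phi then X (r + (r + s)) w else 1) * X r t.
Proof.
move=> pos_r pos_s Phi_rs out.
have [Phi_r Phi_s] := (pos_rootW pos_r, pos_rootW pos_s).
have pos_rs : r + s \in Pos by rewrite pos_rootDE.
have [c Nc Dc] := a_br Phi_r Phi_s Phi_rs.
pose Z := a (r + s) *~ c.
have [W [c2 [DW DZ WX WY WZ]]] : exists W, exists c2 : int,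
  [/\ W = (if r + (r + s) \in Phi then a (r + (r + s)) *~ c2 else 0),
      a r *m Z = Z *m a r + W *+ 2, a r *m W = W *m a r,
      W *m a s = a s *m W & W *m Z = Z *m W].
  have mulMz (A B : 'M[int]_n.+1) k : A *m (B *~ k) = (A *m B) *~ k.
    exact: mulrzAr.
  have Mzmul (A B : 'M[int]_n.+1) k : (A *~ k) *m B = (A *m B) *~ k.
    exact: mulrzAl.
  have acomm u v : u \in Pos -> v \in Pos -> u + v \notin Phi ->
      a u *m a v = a v *m a u.
    move=> pos_u pos_v; apply: a_comm (pos_rootW pos_u) (pos_rootW pos_v) _.
    exact: pos_root_sum_neq0.
  have [Phi_2rs|out2] := boolP (r + (r + s) \in Phi); last first.
    exists 0, 0; rewrite !mul0mx !mulmx0; split=> //.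
    by rewrite mul0rn addr0 mulMz Mzmul acomm.
  have pos_2rs : r + (r + s) \in Pos by rewrite pos_rootDE.
  have [c' Nc' Dc'] := a_br Phi_r (pos_rootW pos_rs) Phi_2rs.
  have [_ out3 out4] := root_string_B2 Phi_r Phi_s Phi_rs Phi_2rs.
  have out5 := root_string3 Phi_r Phi_s Phi_rs Phi_2rs.
  have [k Dk] : exists k, c' = k * 2.
    move: Nc'; rewrite addrAC subrr add0r Phi_s.
    by case/eq_abs2=> ->; [exists 1 | exists (-1)].
  exists (a (r + (r + s)) *~ (k * c)), (k * c); split=> //.
  - by rewrite mulMz Mzmul Dc' mulrzDl Dk pmulrn -!mulrzA mulrAC.
  - by rewrite mulMz Mzmul acomm.
  - by rewrite mulMz Mzmul (acomm s).
  - by rewrite mulMz Mzmul [in LHS]mulMz [in RHS]Mzmul (acomm (r + s)).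
have Ya : redp Z = c%:~R *: redp (a (r + s)) by rewrite redpMz.
have tf A k : A *+ k.+1 = 0 -> A = 0 := @int_mx_torsion_free A k.
have cube u : u \in Phi -> a u * a u * a u = 0.
  by move=> Phi_u; rewrite -mulrA -!mulmxE a_cube.
have X3 := cube r Phi_r; have Y3 := cube s Phi_s.
have Z3 : Z * Z * Z = 0.
  by rewrite /Z !(mulrzAl, mulrzAr) (cube _ (pos_rootW pos_rs)) !mul0rz.
have ZY : Z * a s = a s * Z.
  rewrite /Z mulrzAl mulrzAr; congr (_ *~ _).
  have := a_comm Phi_s (pos_rootW pos_rs) (pos_root_sum_neq0 pos_s pos_rs) out.
  by move/esym.
exists c%:~R; first by apply: intr_Fp_neq0; rewrite Nc; case: (_ \in _).
move=> t u; exists (t ^+ 2 * u * c2%:~R).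
have -> : (if r + (r + s) \in Phi
           then X (r + (r + s)) (t ^+ 2 * u * c2%:~R) else 1)
    = exp2 ((t ^+ 2 * u) *: redp W).
  rewrite DW; case: ifP => _; first by rewrite redpMz /X scalerA.
  by rewrite /redp map_mx0 scaler0 /exp2 mul0r scaler0 !addr0.
have -> : X (r + s) (c%:~R * t * u) = exp2 ((t * u) *: redp Z).
  by rewrite Ya scalerA [t * u * _]mulrC mulrA.
have redp0 A : A = 0 -> redp A = 0 by move->; rewrite /redp map_mx0.
have DZ' : a r * Z = Z * a r + (W + W) by rewrite -mulr2n; exact: DZ.
apply: exp2_string_scaled; rewrite -?redpM -?redpD; first exact: two_Fp_neq0.
- exact (congr1 redp Dc).
- exact (congr1 redp DZ').
- exact (congr1 redp ZY).
- exact (congr1 redp WY).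
- exact (congr1 redp WZ).
- exact (redp0 _ (string_ZXX tf Dc DZ WX X3)).
- exact (redp0 _ (string_WXX tf Dc DZ WX X3)).
- exact (redp0 _ (string_YYZ tf Dc ZY Y3)).
- exact (redp0 _ (string_YZZ tf Dc DZ ZY Y3)).
- exact (redp0 _ (string_YZW tf Dc DZ WX ZY WZ Y3 Z3)).
- exact (redp0 _ (string_ZZW tf DZ WZ Z3)).
- exact (redp0 _ (string_YWW tf Dc DZ WX ZY WZ Y3 Z3)).
- exact (redp0 _ (string_ZWW tf DZ WX WZ Z3)).
Qed.

Lemma unipotent_mx_unit r t : r \in Phi -> X r t \is a GRing.unit.
Proof.
move=> Phi_r; apply/unitrP; exists (X r (- t)).
have D u v := esym (unipotent_mxD u v Phi_r).
by split; [rewrite (D (- t) t) addNr | rewrite (D t (- t)) addrN];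
  rewrite unipotent_mx0.
Qed.

Definition unipotent_elt : V -> 'F_p -> {'GL_n.+1['F_p]} :=
  locked (fun r t => insubd (1%g : {'GL_n.+1['F_p]}) (X r t)).

Local Notation x := unipotent_elt.

Lemma GLval_inj (u v : {'GL_n.+1['F_p]}) : GLval u = GLval v -> u = v.
Proof. exact: val_inj. Qed.

Lemma val_unipotent_elt r t : r \in Phi -> GLval (x r t) = X r t.
Proof.
move=> Phi_r; rewrite /unipotent_elt -lock.
by apply: insubdK; apply: unipotent_mx_unit.
Qed.

Lemma unipotent_eltD r t u : r \in Pos -> x r (t + u) = (x r t * x r u)%g.
Proof.
move/pos_rootW=> Phi_r; apply: GLval_inj.
have E v := val_unipotent_elt v Phi_r.
rewrite GL_ME (E (t + u)) (E t) (E u); exact: unipotent_mxD.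
Qed.

Lemma unipotent_elt0 r : r \in Pos -> x r 0 = 1%g.
Proof.
move/pos_rootW=> Phi_r; apply: GLval_inj.
by rewrite val_unipotent_elt // unipotent_mx0.
Qed.

Lemma unipotent_eltV r t : r \in Pos -> ((x r t)^-1)%g = x r (- t).
Proof.
move=> pos_r; apply: (mulgI (x r t)).
by rewrite mulgV -(unipotent_eltD t (- t) pos_r) addrN unipotent_elt0.
Qed.

Lemma unipotent_eltC r s t u : r \in Pos -> s \in Pos -> r + s \notin Pos ->
  commute (x r t) (x s u).
Proof.
move=> pos_r pos_s; rewrite pos_rootDE // => out; apply: GLval_inj.
have E v := val_unipotent_elt v (pos_rootW pos_r).
have E' v := val_unipotent_elt v (pos_rootW pos_s).
rewrite !GL_ME (E t) (E' u); exact: unipotent_mxC.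
Qed.

Local Notation G := (root_filtration Pos (@height d T) x).

Lemma unipotent_elt_string r s :
    r \in Pos -> s \in Pos -> r + s \in Phi -> s + (r + s) \notin Phi ->
  exists2 c : 'F_p, c != 0 & forall t u, exists2 w,
    w \in G (height (r + s)).+1 /\ (forall v, commute w (x (r + s) v))
    & [~ x s u, x r t]%g = (x (r + s)%R (c * t * u)%R * w)%g.
Proof.
move=> pos_r pos_s Phi_rs out.
have [c c_nz Dx] := unipotent_mx_string pos_r pos_s Phi_rs out.
have pos_rs : r + s \in Pos by rewrite pos_rootDE.
exists (- c); rewrite ?oppr_eq0 // => t u; have [w Dw] := Dx (- t) u.
exists (if r + (r + s) \in Phi then x (r + (r + s)) w else 1%g).
  case: ifP => [Phi_2rs|_]; last by split=> [|v];
    [apply: group1 | apply/commute_sym/commute1].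
  have pos_2rs : r + (r + s) \in Pos by rewrite pos_rootDE.
  split=> [|v].
    apply: (mem_root_filtration _ _ pos_2rs).
    have -> := pos_root_heightD d_gt0 d_gt1 pos_r pos_rs pos_2rs.
    by rewrite -add1n leq_add2r; case: (pos_root_height d_gt0 d_gt1 pos_r).
  apply: (unipotent_eltC w v pos_2rs pos_rs);
    rewrite (pos_rootDE pos_2rs pos_rs).
  have [_ _] :=
    root_string_B2 (pos_rootW pos_r) (pos_rootW pos_s) Phi_rs Phi_2rs.
  by rewrite addrC.
set z := if _ then _ else _.
have Ez : GLval z = if r + (r + s) \in Phi then X (r + (r + s)) w else 1.
  rewrite /z; case: ifP => [Phi_2rs|_]; last exact: GL_1E.
  exact: val_unipotent_elt.
have Er v := val_unipotent_elt v (pos_rootW pos_r).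
have Es v := val_unipotent_elt v (pos_rootW pos_s).
have Ers v := val_unipotent_elt v Phi_rs.
have key : (x r (- t) * x s u
      = x s u * x (r + s)%R (c * - t * u)%R * z * x r (- t))%g.
  apply: GLval_inj; rewrite !GL_ME (Er (- t)) (Es u) (Ers (c * - t * u)) Ez.
  exact: Dw.
rewrite /commg /conjg (unipotent_eltV t pos_r) !mulgA
  -(mulgA _ (x r _) (x s u)).
rewrite key !mulgA mulVg mul1g -(mulgA _ (x r _) (x r t)).
rewrite -(unipotent_eltD (- t) t pos_r) addNr (unipotent_elt0 pos_r) mulg1.
by rewrite mulrN -mulNr.
Qed.

Lemma unipotent_elt_comm r s : r \in Pos -> s \in Pos -> r + s \in Pos ->
  exists2 c : 'F_p, c != 0 & forall t u, exists2 z,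
    z \in G (height (r + s)).+1
    & [~ x r t, x s u]%g = (x (r + s)%R (c * t * u)%R * z)%g.
Proof.
move=> pos_r pos_s pos_rs; have Phi_rs := pos_rootW pos_rs.
have Phi_sr : s + r \in Phi by rewrite addrC.
have [Phi_2rs|out] := boolP (r + (r + s) \in Phi).
  have [out _ _] :=
    root_string_B2 (pos_rootW pos_r) (pos_rootW pos_s) Phi_rs Phi_2rs.
  have [c c_nz Dc] := unipotent_elt_string pos_r pos_s Phi_rs out.
  exists (- c) => [|t u]; first by rewrite oppr_eq0.
  have [w [Gw cwx] Dw] := Dc t u; exists (w^-1)%g; first by rewrite groupV.
  rewrite -invg_comm Dw invMg (unipotent_eltV _ pos_rs) -mulNr -mulNr.
  by apply: commute_sym; apply: commuteV; apply: commute_sym; apply: cwx.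
have out' : r + (s + r) \notin Phi by rewrite (addrC s r).
have [c c_nz Dc] := unipotent_elt_string pos_s pos_r Phi_sr out'.
exists c => // t u; have [w [Gw _] Dw] := Dc u t.
rewrite (addrC s r) in Gw Dw; exists w => //; rewrite Dw.
by rewrite -!mulrA (mulrC u).
Qed.

(** The factor 2 is there because [wt] is twice a height. *)
Definition raises (k : nat) (M : 'M['F_p]_n.+1) : bool :=
  [forall i, forall j, (M i j != 0) ==> (wt j + 2 * k%:Z <= wt i)].

Implicit Types A B M : 'M['F_p]_n.+1.

Lemma raisesP k M :
  reflect (forall i j, M i j != 0 -> wt j + 2 * k%:Z <= wt i) (raises k M).
Proof.
apply: (iffP forallP) => [rM i j nz|rM i].
  by have /forallP/(_ j)/implyP := rM i; apply.
by apply/forallP=> j; apply/implyP; apply: rM.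
Qed.

Lemma raises0 k : raises k 0.
Proof. by apply/raisesP=> i j; rewrite mxE eqxx. Qed.

Lemma raisesD k A B : raises k A -> raises k B -> raises k (A + B).
Proof.
move=> /raisesP rA /raisesP rB; apply/raisesP=> i j; rewrite mxE.
have [A0|nzA _] := eqVneq (A i j) 0; first by rewrite A0 add0r; apply: rB.
exact: rA.
Qed.

Lemma raisesZ k c A : raises k A -> raises k (c *: A).
Proof.
move/raisesP=> rA; apply/raisesP=> i j.
by rewrite mxE mulf_eq0 => /norP[_]; apply: rA.
Qed.

Lemma raisesM k l A B : raises k A -> raises l B -> raises (k + l) (A * B).
Proof.
move=> /raisesP rA /raisesP rB; apply/raisesP=> i j; rewrite mxE => nz.
have [m nz_m] : exists m, A i m * B m j != 0.
  apply/existsP; apply: contraNT nz => /existsPn nz; rewrite big1 // => m _.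
  by apply/eqP; have := nz m; rewrite negbK.
move: nz_m; rewrite mulf_eq0 => /norP[/rA ? /rB ?]; lia.
Qed.

Lemma raises_leq k l A : (l <= k)%N -> raises k A -> raises l A.
Proof.
by move=> le_lk /raisesP rA; apply/raisesP=> i j /rA ?; lia.
Qed.

Lemma raises_root r : r \in Pos -> raises (height r) (redp (a r)).
Proof.
move=> pos_r; apply/raisesP=> i j; rewrite mxE => nz.
have nz_a : a r i j != 0 by apply: contraNneq nz => ->.
have [_ <-] := pos_root_height d_gt0 d_gt1 pos_r.
by rewrite (a_graded (pos_rootW pos_r) nz_a).
Qed.

Lemma raises_sqr_root r : r \in Pos ->
  raises (height r + height r) (redp (a r) * redp (a r)).
Proof. by move=> pos_r; apply: raisesM; apply: raises_root. Qed.

(** The identity [u v - 1 = (u - 1) (v - 1) + (u - 1) + (v - 1)] makes this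
    property multiplicative. *)
Lemma raises_filtration k g : g \in G k -> raises k (GLval g - 1).
Proof.
move=> Gg; pose P := [pred g : {'GL_n.+1['F_p]} | raises k (GLval g - 1)].
apply: (@root_filtration_ind _ _ _ _ _ _ _ P _ _ _ g Gg).
- by rewrite inE GL_1E subrr raises0.
- move=> u v _ _; rewrite !inE GL_ME => ru rv.
  have -> : GLval u * GLval v - 1
      = (GLval u - 1) * (GLval v - 1) + (GLval u - 1) + (GLval v - 1).
    rewrite mulrBl mul1r mulrBr mulr1 -(addrA _ (GLval u - 1)).
    by rewrite (addrC (GLval u - 1)) addrA subrK addrA subrK.
  by apply: raisesD => //; apply: raisesD => //;
    apply: raises_leq (raisesM ru rv); apply: leq_addr.
move=> r t pos_r le_kr; rewrite inE (val_unipotent_elt t (pos_rootW pos_r)).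
rewrite unipotent_mxE -(addrA 1) (addrC 1) addrK.
apply: raisesD; apply: raisesZ;
  [move: (raises_root pos_r) | move: (raises_sqr_root pos_r)];
  apply: raises_leq.
  exact: le_kr.
by apply: leq_trans le_kr _; apply: leq_addr.
Qed.

Definition detects s (ij : 'I_n.+1 * 'I_n.+1) : bool :=
  [&& wt ij.1 == height2 s, wt ij.2 == 0, (a s ij.1 ij.2)%:~R != 0 :> 'F_p
    & all (fun r => a r ij.1 ij.2 == if r == s then a s ij.1 ij.2 else 0) Pos].

(** The entry provided by [a_detect], scaled so that it maps [x s t] to [t]. *)
Definition root_coordinate s (g : {'GL_n.+1['F_p]}) : 'F_p :=
  if [pick ij | detects s ij] is Some ij
  then GLval g ij.1 ij.2 / (a s ij.1 ij.2)%:~R else 0.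

Lemma root_coordinateP s : s \in Pos -> exists i, exists j,
  [/\ wt i = height2 s, wt j = 0, (a s i j)%:~R != 0 :> 'F_p,
      {in Pos, forall r, a r i j = if r == s then a s i j else 0}
    & root_coordinate s =1 fun g => GLval g i j / (a s i j)%:~R].
Proof.
move=> pos_s; rewrite /root_coordinate; case: pickP => [[i j] /and4P[/=]|none].
  by move=> /eqP wi /eqP wj nz /allP Ha; exists i, j; split=> // r /Ha/eqP.
have [i [j [k [wi wj k_small Ha]]]] := a_detect pos_s.
have as_k : a s i j = k by rewrite Ha // eqxx.
have := none (i, j); rewrite /detects /= wi wj !eqxx as_k intr_Fp_neq0 //=.
by move/negbT/allPn=> [r pos_r]; rewrite Ha ?eqxx.
Qed.

(** The entry is at distance exactly [height s] in the grading, and the product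
    [(g - 1) (h - 1)] raises heights by at least twice as much. *)
Lemma root_coordinateM s : s \in Pos ->
  {in G (height s) &, forall g h : {'GL_n.+1['F_p]},
     root_coordinate s (g * h)%g = root_coordinate s g + root_coordinate s h}.
Proof.
move=> pos_s g h /raises_filtration rg /raises_filtration rh.
have [i [j [wi wj _ _ Dc]]] := root_coordinateP pos_s.
have [ht_gt0 Dht] := pos_root_height d_gt0 d_gt1 pos_s.
rewrite !Dc -mulrDl GL_ME; congr (_ / _).
have -> : GLval g * GLval h
    = (GLval g - 1) * (GLval h - 1) + GLval g + GLval h - 1.
  rewrite mulrBl mul1r mulrBr mulr1 -(addrA _ (GLval h)).
  by rewrite (addrAC _ (- (GLval h - 1))) subrK subrK.
have ne_ij : i != j by apply: contraTneq ht_gt0 => ij; rewrite ij in wi; lia.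
have M0 : ((GLval g - 1) * (GLval h - 1)) i j = 0.
  by apply/eqP; apply/negP=> /negP/(raisesP _ _ (raisesM rg rh)); lia.
move: ((GLval g - 1) * (GLval h - 1)) M0 => M M0.
by rewrite !mxE M0 add0r (negPf ne_ij) subr0.
Qed.

Lemma root_coordinate_x r s t : r \in Pos -> s \in Pos ->
  (height s <= height r)%N ->
  root_coordinate s (x r t) = if r == s then t else 0.
Proof.
move=> pos_r pos_s le_sr.
have [i [j [wi wj nz Ha Dc]]] := root_coordinateP pos_s.
have [ht_gt0 Dht] := pos_root_height d_gt0 d_gt1 pos_s.
have ne_ij : i != j by apply: contraTneq ht_gt0 => ij; rewrite ij in wi; lia.
have S0 : (redp (a r) * redp (a r)) i j = 0.
  by apply/eqP; apply/negP=> /negP/(raisesP _ _ (raises_sqr_root pos_r)); lia.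
rewrite Dc (val_unipotent_elt t (pos_rootW pos_r)) unipotent_mxE.
move: (redp (a r) * redp (a r)) S0 => S S0.
rewrite !mxE S0 mulr0 addr0 (negPf ne_ij) add0r Ha //.
by case: ifP => _; rewrite ?mulr0 ?mul0r // mulfK.
Qed.

Hypothesis al_inj : injective (fun i : 'I_d => simple_root d T i).

Lemma pos_root_decomp_ord r : r \in Pos ->
  exists i : 'I_d, r = simple_root d T i \/ r - simple_root d T i \in Pos.
Proof. by case/pos_root_decomp=> i lt_id H; exists (Ordinal lt_id). Qed.

Definition unipotent_series := root_group_series p_prime
  (fun i : 'I_d => simple_root_pos d_gt1 (ltn_ord i)) al_inj
  (fun i : 'I_d => height_simple_root d_gt1 (ltn_ord i))
  (fun r pos_r => proj1 (pos_root_height d_gt0 d_gt1 pos_r))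
  (fun r s => @pos_root_heightD T d r s d_gt0 d_gt1)
  pos_root_decomp_ord unipotent_eltD unipotent_eltC unipotent_elt_comm
  root_coordinateM root_coordinate_x.
End UnipotentMatrices.

(** * Simple roots that act on a layer *)

Section LastAction.

Local Open Scope ring_scope.

Variable d : nat.
Local Notation dim T := (ambient_dim T d).

Lemma height_eq T (r : 'rV[int]_(dim T)) k : height2 r = 2 * k%:Z ->
  height r = k.
Proof. by rewrite /height => ->; lia. Qed.

Lemma height_diff T i j : (i < j)%N -> (j < dim T)%N ->
  height (eps (dim T) i - eps (dim T) j) = (j - i)%N.
Proof.
move=> lt_ij lt_jn; apply: height_eq; rewrite !heightE !height2_eps //;
  last lia.
by rewrite /height_weight; case: T lt_jn; lia.
Qed.

Definition sum_height T i j : nat :=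
  match T with
  | TypeA | TypeB => 2 * d - i - j
  | TypeC => 2 * d - 1 - i - j
  | TypeD => 2 * d - 2 - i - j
  end%N.

Lemma height_sum T i j : T <> TypeA -> (i < j)%N -> (j < dim T)%N ->
  height (eps (dim T) i + eps (dim T) j) = sum_height T i j.
Proof.
move=> nA lt_ij lt_jn; apply: height_eq; rewrite !heightE !height2_eps //;
  last lia.
by rewrite /height_weight; case: T nA lt_jn => //=; lia.
Qed.

Lemma height_short i : (i < d)%N ->
  height (eps d i : 'rV_(dim TypeB)) = (d - i)%N.
Proof.
move=> lt_id; apply: height_eq; rewrite (@height2_eps d TypeB) //.
by rewrite /height_weight; lia.
Qed.

Lemma height_long i : (i < d)%N ->
  height (eps d i *+ 2 : 'rV_(dim TypeC)) = sum_height TypeC i i.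
Proof.
move=> lt_id; apply: height_eq; rewrite mulr2n (@height2D d TypeC).
by rewrite !(@height2_eps d TypeC) // /height_weight /=; lia.
Qed.

Lemma pos_root_norm_AD T (r : 'rV[int]_(dim T)) : T = TypeA \/ T = TypeD ->
  r \in pos_roots T d -> dot r r = 2.
Proof.
move=> AD /pos_rootP[i j|i j nA|i tB|i tC] => [||_|_]; last 2 first.
- by rewrite tB in AD; case: AD.
- by rewrite tC in AD; case: AD.
- by move=> ? ? ->; rewrite !dotE !dot_eps //; lia.
- by move=> ? ? ->; rewrite !dotE !dot_eps //; lia.
Qed.

(** All the roots have the same length, so that [(r, al i)] is determined by
    the length of the difference. *)
Lemma dot_simple_root_AD T (r : 'rV[int]_(dim T)) i : T = TypeA \/ T = TypeD ->
    (T = TypeD -> 1 < d)%N -> (i < d)%N -> r \in pos_roots T d ->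
    r - simple_root d T i \in pos_roots T d ->
  dot r (simple_root d T i) = 1.
Proof.
move=> AD d_gt1 lt_id pos_r pos_s; have pos_i := simple_root_pos d_gt1 lt_id.
have := pos_root_norm_AD AD pos_s; rewrite !dotE.
rewrite (pos_root_norm_AD AD pos_r) (pos_root_norm_AD AD pos_i).
by rewrite (dotC (simple_root d T i)); lia.
Qed.

Lemma pos_root_long (u : 'rV[int]_(dim TypeC)) :
    u \in pos_roots TypeC d -> 4 <= dot u u ->
  exists2 k, (k < d)%N & u = eps d k *+ 2.
Proof.
case/pos_rootP=> // [i j|i j _|i _] => [lt_ij|lt_ij|] /= lt_jd ->;
  last by exists i.
- by rewrite !dotE !dot_eps //; lia.
- by rewrite !dotE !dot_eps //; lia.
Qed.

(** The largest height of a root that stays a positive root when the simple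
    root number [i] is subtracted. *)
Definition last_height T (i : nat) : nat :=
  match T with
  | TypeA => maxn i.+1 (d - i)
  | TypeB => if i == 0%N then 2 * d - 2 else 2 * d - i
  | TypeC => 2 * d - 1 - i
  | TypeD => if i == 0%N then 2 * d - 4
             else if i.+1 == d then d else 2 * d - 2 - i
  end%N.

Lemma last_heightD i : (i < d)%N -> (3 < d)%N ->
  [/\ i = 0%N -> last_height TypeD i = (2 * d - 4)%N,
      i.+1 = d -> last_height TypeD i = d
    & (0 < i)%N -> (i.+1 < d)%N -> last_height TypeD i = (2 * d - 2 - i)%N].
Proof.
move=> lt_id d_gt3; rewrite /last_height; split; first by move->.
- by move=> Di; rewrite Di eqxx; case: eqP => //; lia.
- by move=> i_gt0 lt_i1d; rewrite gtn_eqF // ltn_eqF.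
Qed.

(** In types A, B and D it is enough to know that the difference has the length
    of a root; in type C it matters as well that the vectors of squared length
    4 among the roots are the doubles of basis vectors. *)
Lemma height_le_last T (r : 'rV[int]_(dim T)) i :
    (1 < d)%N -> (T = TypeD -> 3 < d)%N -> (i < d)%N ->
    r \in pos_roots T d -> r - simple_root d T i \in pos_roots T d ->
  (height r <= last_height T i)%N.
Proof.
move=> d_gt1 d_gt3 lt_id; case: T r d_gt3 => r d_gt3.
- move=> pos_r pos_s;
  have := dot_simple_root_AD (or_introl erefl) _ lt_id pos_r pos_s.
  move=> /(_ (fun=> d_gt1)); move: pos_s => _.
  case/pos_rootP: pos_r => // a b lt_ab lt_bd ->; rewrite height_diff //.
  rewrite simple_root_diff //; rewrite /= in lt_bd.
  by rewrite !dotE !dot_eps //=; lia.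
- move=> pos_r /pos_root_norm; rewrite /last_height /short_norm.
  have [lt_i1d|le_di] := ltnP i.+1 d.
    rewrite simple_root_diff //.
    case/pos_rootP: pos_r => // [a b|a b _|a _] =>
      [lt_ab lt_bd|lt_ab lt_bd|lt_ad] ->.
    + by move=> _; rewrite height_diff //; rewrite /= in lt_bd; case: ifP; lia.
    + rewrite height_sum //; rewrite /= in lt_bd.
      by rewrite !dotE !dot_eps //=; try (case: ifP); lia.
    + by move=> _; rewrite height_short //; case: ifP; lia.
  have Di : i.+1 = d by lia.
  rewrite /simple_root Di eqxx.
  case/pos_rootP: pos_r => // [a b|a b _|a _] =>
    [lt_ab lt_bd|lt_ab lt_bd|lt_ad] ->.
  + by move=> _; rewrite height_diff //; rewrite /= in lt_bd; case: ifP; lia.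
  + rewrite height_sum //; rewrite /= in lt_bd.
    by rewrite !dotE !dot_eps //=; try (case: ifP); lia.
  + by move=> _; rewrite height_short //; case: ifP; lia.
- move=> pos_r pos_s; rewrite /last_height.
  have [lt_i1d|le_di] := ltnP i.+1 d.
    rewrite simple_root_diff // in pos_s.
    (* A root of type C of norm 4 is twice a basis vector: this excludes the
       difference of two roots with disjoint supports. *)
    have bound a b : (a <= b)%N -> (b < d)%N ->
        eps d a + eps d b - (eps d i - eps d i.+1) \in pos_roots TypeC d ->
      (2 * d - 1 - a - b <= 2 * d - 1 - i)%N.
      move=> le_ab lt_bd; have [lt_abi|] := ltnP (a + b) i; last lia.
      set u := _ - _ => pos_u.
      have Nu : 4 <= dot u u by rewrite /u !dotE !dot_eps //; lia.
      have ui : dot u (eps d i) = -1 by rewrite /u !dotE !dot_eps //; lia.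
      have [k lt_kd Du] := pos_root_long pos_u Nu.
      by move: ui; rewrite Du dotMnl dot_eps //; lia.
    case/pos_rootP: pos_r pos_s => // [a b|a b _|a _] =>
      [lt_ab|lt_ab|] lt_bd ->.
    + by move=> _; rewrite /= in lt_bd; clear bound;
        rewrite (@height_diff TypeC) //=; lia.
    + rewrite (@height_sum TypeC) //.
      by apply: bound; first exact: ltnW.
    + by rewrite height_long // mulr2n; apply: bound.
  have Di : i.+1 = d by lia.
  move: pos_s; rewrite /simple_root Di eqxx => /pos_root_norm.
  rewrite /short_norm.
  case/pos_rootP: pos_r => // [a b|a b _|a _] => [lt_ab|lt_ab|] /= lt_bd ->.
  + by move=> _; rewrite (@height_diff TypeC) //; lia.
  + by rewrite (@height_sum TypeC) // /sum_height !dotE !dot_eps //=; lia.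
  + by rewrite height_long // /sum_height !dotE !dot_eps //=; lia.
- have {}d_gt3 := d_gt3 erefl.
  move=> pos_r pos_s;
  have := dot_simple_root_AD (or_intror erefl) _ lt_id pos_r pos_s.
  move=> /(_ (fun=> d_gt1)); move: pos_s => _.
  have [H0 H1 H2] := last_heightD lt_id d_gt3.
  move: (last_height TypeD i) H0 H1 H2 => H H0 H1 H2.
  have [lt_i1d|le_di] := ltnP i.+1 d.
    rewrite simple_root_diff //.
    case/pos_rootP: pos_r => // [a b|a b _] => lt_ab lt_bd ->.
    + by move=> _; rewrite height_diff //; rewrite /= in lt_bd; lia.
    + rewrite height_sum //; rewrite /= in lt_bd.
      by rewrite /sum_height !dotE !dot_eps //=; lia.
  have Di : i.+1 = d by lia.
  rewrite /simple_root Di eqxx.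
  case/pos_rootP: pos_r => // [a b|a b _] => lt_ab lt_bd ->.
  + by move=> _; rewrite height_diff //; rewrite /= in lt_bd; lia.
  + rewrite height_sum //; rewrite /= in lt_bd.
    by rewrite /sum_height !dotE !dot_eps //=; lia.
Qed.

End LastAction.

Section DefinableSets.

Local Open Scope ring_scope.

Variable d : nat.
Local Notation dim T := (ambient_dim T d).

Lemma last_height_attained T i :
    (1 < d)%N -> (T = TypeD -> 3 < d)%N -> (i < d)%N ->
  exists2 r : 'rV[int]_(dim T), r \in pos_roots T d &
    r - simple_root d T i \in pos_roots T d /\ height r = last_height d T i.
Proof.
move=> d_gt1 d_gt3 lt_id; case: T d_gt3 => d_gt3.
- have [le_id|lt_di] := leqP i.+1 (d - i).
    have lt_i1 : (i.+1 < d)%N by lia.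
    exists (eps d.+1 i - eps d.+1 d).
      by apply/pos_rootP/(@PosDiff _ TypeA _ i d).
    rewrite (@height_diff _ TypeA) // simple_root_diff; last exact: ltnW.
    split; last by rewrite /last_height /=; lia.
    by apply/pos_rootP/(@PosDiff _ TypeA _ i.+1 d) => //; vector_eq.
  have i_gt0 : (0 < i)%N by lia.
  exists (eps d.+1 0 - eps d.+1 i.+1).
    by apply/pos_rootP/(@PosDiff _ TypeA _ 0 i.+1).
  rewrite (@height_diff _ TypeA) // simple_root_diff //.
  split; last by rewrite /last_height /=; lia.
  by apply/pos_rootP/(@PosDiff _ TypeA _ 0 i) => //; [apply: ltnW|vector_eq].
- have [lt_i1|le_di] := ltnP i.+1 d; last first.
    have Di : i.+1 = d by lia.
    exists (eps d 0 + eps d i).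
      by apply/pos_rootP/(@PosSum _ TypeB _ 0 i) => //; lia.
    rewrite (@height_sum _ TypeB) //; last lia.
    rewrite /simple_root Di eqxx; split; last first.
      by rewrite /last_height /sum_height; case: eqP; lia.
    by apply/pos_rootP/(@PosShort _ TypeB _ 0) => //; [exact: ltnW | vector_eq].
  have [i0|i_gt0] := posnP i.
    have [d_gt2|le_d2] := ltnP 2 d.
      exists (eps d 0 + eps d 2);
        first by apply/pos_rootP/(@PosSum _ TypeB _ 0 2).
      rewrite (@height_sum _ TypeB) // simple_root_diff // i0.
      split; last by rewrite /last_height /sum_height /=; lia.
      by apply/pos_rootP/(@PosSum _ TypeB _ 1 2) => //; vector_eq.
    exists (eps d 0); first by apply/pos_rootP/(@PosShort _ TypeB _ 0) => //=;
      lia.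
    rewrite height_short ?(ltnW d_gt1) // simple_root_diff // i0.
    split; last by rewrite /last_height /=; lia.
    by apply/pos_rootP/(@PosShort _ TypeB _ 1) => //; vector_eq.
  exists (eps d 0 + eps d i); first by apply/pos_rootP/(@PosSum _ TypeB _ 0 i).
  rewrite (@height_sum _ TypeB) // simple_root_diff //.
  split; last by rewrite /last_height /sum_height gtn_eqF //; lia.
  by apply/pos_rootP/(@PosSum _ TypeB _ 0 i.+1) => //; vector_eq.
- have [lt_i1|le_di] := ltnP i.+1 d; last first.
    have Di : i.+1 = d by lia.
    exists (eps d 0 + eps d i).
      by apply/pos_rootP/(@PosSum _ TypeC _ 0 i) => //; lia.
    rewrite (@height_sum _ TypeC) //; last lia.
    rewrite /simple_root Di eqxx; split; last first.
      by rewrite /last_height /sum_height; lia.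
    by apply/pos_rootP/(@PosDiff _ TypeC _ 0 i) => //; [lia | vector_eq].
  have [i0|i_gt0] := posnP i.
    exists (eps d 0 *+ 2); first by apply/pos_rootP/(@PosLong _ TypeC _ 0) =>
      //=; lia.
    rewrite height_long ?(ltnW d_gt1) // simple_root_diff // i0.
    split; last by rewrite /last_height /sum_height /=; lia.
    by apply/pos_rootP/(@PosSum _ TypeC _ 0 1) => //; vector_eq.
  exists (eps d 0 + eps d i); first by apply/pos_rootP/(@PosSum _ TypeC _ 0 i).
  rewrite (@height_sum _ TypeC) // simple_root_diff //.
  split; last by rewrite /last_height /sum_height /=; lia.
  by apply/pos_rootP/(@PosSum _ TypeC _ 0 i.+1) => //; vector_eq.
- have {}d_gt3 := d_gt3 erefl; have [H0 H1 H2] := last_heightD lt_id d_gt3.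
  have [lt_i1|le_di] := ltnP i.+1 d; last first.
    have Di : i.+1 = d by lia.
    have lt_0i : (0 < i.-1)%N by lia.
    exists (eps d 0 + eps d i.-1).
      by apply/pos_rootP/(@PosSum _ TypeD _ 0 i.-1) => //=; lia.
    rewrite (@height_sum _ TypeD) //; last by rewrite /=; lia.
    rewrite /simple_root Di eqxx; split; last by rewrite H1 // /sum_height; lia.
    by apply/pos_rootP/(@PosDiff _ TypeD _ 0 i) => //; [lia | vector_eq].
  rewrite simple_root_diff //.
  have [i0|i_gt0] := posnP i.
    have lt_2d : (2 < d)%N by lia.
    exists (eps d 0 + eps d 2);
      first by apply/pos_rootP/(@PosSum _ TypeD _ 0 2).
    rewrite (@height_sum _ TypeD) // H0 // i0; split;
      last by rewrite /sum_height; lia.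
    by apply/pos_rootP/(@PosSum _ TypeD _ 1 2) => //; vector_eq.
  exists (eps d 0 + eps d i); first by apply/pos_rootP/(@PosSum _ TypeD _ 0 i).
  rewrite (@height_sum _ TypeD) // H2 //; split; last by rewrite /sum_height;
    lia.
  by apply/pos_rootP/(@PosSum _ TypeD _ 0 i.+1) => //; vector_eq.
Qed.

Local Notation al T := (fun i : 'I_d => simple_root d T i).
Local Notation definable T := (definable (pos_roots T d) (al T) (@height d T)).

(** A simple root acts at some layer from [k] on exactly when it can be
    subtracted from a root of height greater than [k]. *)
Lemma definable_le T k : (1 < d)%N -> (T = TypeD -> 3 < d)%N ->
  definable T [set i : 'I_d | (last_height d T i <= k)%N].
Proof.
move=> d_gt1 d_gt3; exists (leq k) => i; rewrite inE; split=> [le_k l _ le_kl|].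
  apply/hasP=> [[r pos_r /andP[/eqP ht_r pos_s]]].
  have := height_le_last d_gt1 d_gt3 (ltn_ord i) pos_r pos_s.
  by rewrite ht_r => lt_l; have := leq_trans lt_l (leq_trans le_k le_kl);
    rewrite ltnn.
move=> nact; rewrite leqNgt; apply/negP=> lt_k.
have [r pos_r [pos_s ht_r]] := last_height_attained d_gt1 d_gt3 (ltn_ord i).
have d_gt0 := ltnW d_gt1.
have ht_s : height r = ((height (r - simple_root d T i)).+1)%N.
  have tD : T = TypeD -> (1 < d)%N by [].
  have pos_i := simple_root_pos tD (ltn_ord i).
  have := pos_root_heightD d_gt0 tD pos_s pos_i.
  by rewrite subrK height_simple_root // addn1; apply.
have [s_gt0 _] := pos_root_height d_gt0 (fun=> d_gt1) pos_s.
have := nact (height (r - simple_root d T i)) s_gt0.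
rewrite -ltnS -ht_s ht_r => /(_ lt_k)/negP; apply.
by apply/hasP; exists r; rewrite // ht_s eqxx pos_s.
Qed.

(** In type B the only root of height [2 d - 2] is [eps 0 + eps 2], and the
    simple roots number 0 and 2 are those that can be subtracted from it. *)
Lemma definable_B02 : (3 < d)%N ->
  definable TypeB [set i : 'I_d | (i != 0 :> nat) && (i != 2 :> nat)].
Proof.
move=> d_gt3; exists (pred1 (2 * d - 3)%N) => i; rewrite inE.
have lt_2d : (2 < d)%N by lia.
have uniq_root r : r \in pos_roots TypeB d -> height r = (2 * d - 2)%N ->
    r = eps d 0 + eps d 2.
  case/pos_rootP=> // [a b|a b _|a _] => [lt_ab lt_bd|lt_ab lt_bd|lt_ad] ->.
  - by rewrite (@height_diff _ TypeB) //; rewrite /= in lt_bd; lia.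
  - rewrite (@height_sum _ TypeB) // /sum_height => Dab; rewrite /= in lt_bd.
    by have [-> ->] : a = 0%N /\ b = 2%N by lia.
  - by rewrite height_short //; rewrite /= in lt_ad; lia.
have pos_02 : eps d 0 + eps d 2 \in pos_roots TypeB d.
  by apply/pos_rootP/(@PosSum _ TypeB _ 0 2).
have ht_02 : height (eps d 0 + eps d 2 : 'rV_(dim TypeB)) = (2 * d - 2)%N.
  by rewrite (@height_sum _ TypeB) // /sum_height; lia.
split=> [/andP[i0 i2] l _ /eqP->|nact].
  apply/hasP=> [[r pos_r /andP[/eqP ht_r pos_s]]].
  rewrite (uniq_root r pos_r) in pos_s; last by rewrite ht_r; lia.
  have := pos_root_norm pos_s; rewrite /short_norm.
  have lt_id := ltn_ord i; have [lt_i1|le_di] := ltnP i.+1 d.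
    rewrite simple_root_diff // !dotE !dot_eps //=; lia.
  have Di : i.+1 = d by lia.
  rewrite /simple_root Di eqxx !dotE !dot_eps //=; lia.
have lt_id := ltn_ord i.
have pos_act :
    eps d 0 + eps d 2 - simple_root d TypeB i \in pos_roots TypeB d ->
    acts_at (pos_roots TypeB d) (al TypeB) (@height d TypeB) (2 * d - 3) i.
  by move=> pos_s; apply/hasP; exists (eps d 0 + eps d 2);
    rewrite // ht_02 pos_s andbT; lia.
have k_gt0 : (0 < 2 * d - 3)%N by lia.
have := nact _ k_gt0 (eqxx _); apply: contraNT; rewrite negb_and !negbK => i02.
apply: pos_act; rewrite simple_root_diff; last first.
  by case/orP: i02 => /eqP->; rewrite /=; lia.
case/orP: i02 => /eqP->.
  by apply/pos_rootP/(@PosSum _ TypeB _ 1 2) => //; vector_eq.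
by apply/pos_rootP/(@PosSum _ TypeB _ 0 3) => //; vector_eq.
Qed.

End DefinableSets.

(** * The series of sets of simple roots *)

Section Flag.

Variable d : nat.

(** The simple roots that generate the [i]-th term of the series modulo the
    derived subgroup: those with [last_height] at most some threshold, except
    for [i = 1] in type B with [d] even.  In types B and D the order of the
    values of [last_height] is not that of the simple roots for the first few
    ones, which explains the special cases. *)
Definition kept T (i j : nat) : bool :=
  match T with
  | TypeA => (i <= j) && (j < d - i)
  | TypeB => if odd d
             then if (i == 1) && (1 < d) then j != 1 else 2 * i - 1 <= j
             else if (i == 1) && (2 < d) then (j != 0) && (j != 2)
             else 2 * i <= j
  | TypeC => 2 * i <= j
  | TypeD => if odd d then (i == 0) || (2 * i + 1 <= j)
             else if i == 1 then j != 1 else (i != d./2) && (2 * i - 1 <= j)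
  end.

Definition flag T (i : nat) : {set 'I_d} := [set j : 'I_d | kept T i j].

Definition flag_card T (i : nat) : nat :=
  match T with
  | TypeA | TypeC => d - 2 * i
  | TypeB => if odd d then
               if i == 0 then d
               else if (i == 1) && (1 < d) then d - 1 else d + 1 - 2 * i
             else d - 2 * i
  | TypeD => if odd d then if i == 0 then d else d - 1 - 2 * i
             else if i == 1 then d - 1
             else if i == d./2 then 0 else minn d (d + 1 - 2 * i)
  end.

Lemma card_ord_interval lo hi : hi <= d ->
  #|[set j : 'I_d | (lo <= j) && (j < hi)]| = hi - lo.
Proof.
move=> le_hd; rewrite cardsE -sum1_card.
rewrite -(big_ord_widen_cond d (leq lo) (fun=> 1) le_hd).
rewrite -(big_mkord (leq lo) (fun=> 1)).
by rewrite -(@big_nat_widenl _ _ _ lo 0 hi predT) // sum_nat_const_nat muln1.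
Qed.

Lemma card_ord_ge lo : #|[set j : 'I_d | lo <= j]| = d - lo.
Proof.
rewrite -(card_ord_interval lo (leqnn d)); apply: eq_card => j.
by rewrite !inE ltn_ord andbT.
Qed.

Lemma card_ord_neq k : k < d -> #|[set j : 'I_d | j != k :> nat]| = d - 1.
Proof.
move=> lt_kd; have := cardsC1 (Ordinal lt_kd); rewrite card_ord subn1 => <-.
by apply: eq_card => j; rewrite !inE.
Qed.

Lemma card_ord_neq2 k l : k != l -> k < d -> l < d ->
  #|[set j : 'I_d | (j != k :> nat) && (j != l :> nat)]| = d - 2.
Proof.
move=> ne_kl lt_kd lt_ld; pose A := [set Ordinal lt_kd; Ordinal lt_ld].
have cA : #|A| = 2 by rewrite cards2 -val_eqE /= ne_kl.
have := cardsC A; rewrite cA card_ord => Dd.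
apply: (@etrans _ _ #|~: A|); last by lia.
by apply: eq_card => j; rewrite !inE negb_or.
Qed.

Lemma card_flag T i : (T = TypeD -> 3 < d) -> i <= series_length T d ->
  #|flag T i| = flag_card T i.
Proof.
case: T => d_gt3; rewrite /series_length /flag /kept /flag_card => le_im.
- by rewrite card_ord_interval ?leq_subr //; lia.
- case: (boolP (odd d)) => odd_d.
    have [->|ne_i1] /= := eqVneq i 1.
      have [d_gt1|le_d1] := ltnP 1 d; first by rewrite card_ord_neq.
      by rewrite card_ord_ge; lia.
    by rewrite card_ord_ge; case: (i =P 0); lia.
  case: (boolP ((i == 1) && (2 < d))) => [/andP[/eqP-> d_gt2]|_].
    by rewrite card_ord_neq2 // ltnW // ltnW.
  by rewrite card_ord_ge.
- by rewrite card_ord_ge.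
- have {}d_gt3 := d_gt3 erefl; case: (boolP (odd d)) => odd_d.
    have [->|ne_i0] /= := eqVneq i 0.
      apply: etrans (card_ord d); rewrite -cardsT.
      by apply: eq_card => j; rewrite !inE.
    by rewrite card_ord_ge; lia.
  have [_|ne_i1] := eqVneq i 1; first by rewrite card_ord_neq //; lia.
  have [_|ne_im] /= := eqVneq i d./2.
    by apply: eq_card0 => j; rewrite !inE.
  by rewrite card_ord_ge; lia.
Qed.

Lemma flag0 T : flag T 0 = setT.
Proof.
apply/setP=> j; rewrite !inE /kept; have := ltn_ord j.
by case: T; do ?case: ifP => ?; lia.
Qed.

Lemma flag_last T : (T = TypeD -> 3 < d) -> flag T (series_length T d) = set0.
Proof.
move=> d_gt3; apply/setP=> j; rewrite !inE /kept /series_length.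
have := ltn_ord j.
by case: T d_gt3 => d_gt3; try have {}d_gt3 := d_gt3 erefl; do ?case: ifP => ?;
  lia.
Qed.

Lemma flagS T i : (T = TypeD -> 3 < d) -> i < series_length T d ->
  flag T i.+1 \subset flag T i.
Proof.
move=> d_gt3 lt_im; apply/subsetP=> j; rewrite !inE; move: lt_im.
rewrite /kept /series_length.
by case: T d_gt3 => d_gt3; try have {}d_gt3 := d_gt3 erefl; do ?case: ifP => ?;
  lia.
Qed.

Lemma flag_properS T i : (T = TypeD -> 3 < d) -> i < series_length T d ->
  flag T i.+1 \proper flag T i.
Proof.
move=> d_gt3 lt_im; rewrite properEcard flagS //.
rewrite !card_flag // ?(ltnW lt_im) //; move: lt_im;
  rewrite /flag_card /series_length.
by case: T d_gt3 => d_gt3; try have {}d_gt3 := d_gt3 erefl; do ?case: ifP => ?;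
  lia.
Qed.

(** The zero subspace needs a separate treatment: it is invariant, but in the
    smallest ranks no set of layers defines it. *)
Lemma flag_definable T i :
    (T = TypeD -> 3 < d) -> i <= series_length T d ->
  flag T i = set0 \/
  definable (pos_roots T d) (fun i : 'I_d => simple_root d T i)
      (@height d T) (flag T i).
Proof.
move=> d_gt3 le_im.
have [->|i_gt0] := posnP i.
  by right; exists pred0 => j; rewrite flag0 inE.
have [lt_im|ge_im] := ltnP i (series_length T d); last first.
  by left; rewrite (_ : i = series_length T d) ?flag_last //; apply/eqP;
    rewrite eqn_leq le_im.
have d_gt1 : 1 < d.
  by move: lt_im; rewrite /series_length; case: (T); lia.
right;
have def_le k :
    (forall j, j < d -> kept T i j = (last_height d T j <= k)) ->
    definable (pos_roots T d) (fun i : 'I_d => simple_root d T i)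
      (@height d T) (flag T i).
  move=> Dk; rewrite (_ : flag T i = [set j : 'I_d | last_height d T j <= k]).
    exact: definable_le.
  by apply/setP=> j; rewrite !inE Dk.
move: lt_im def_le; rewrite /series_length /kept /last_height.
case: T d_gt3 le_im => d_gt3 _ lt_im def_le.
- by apply: (def_le (d - i)) => j; lia.
- have [odd_d|even_d] := boolP (odd d); have [i1|ne_i1] := eqVneq i 1.
  + apply: (def_le (2 * d - 2)) => j lt_jd.
    by rewrite odd_d i1; case: ifP => ?; case: ifP => ?; lia.
  + apply: (def_le (2 * d + 1 - 2 * i)) => j lt_jd.
    by rewrite odd_d (negPf ne_i1) /=; case: ifP => ?; lia.
  + rewrite (_ : flag TypeB i
                 = [set j : 'I_d | (j != 0 :> nat) && (j != 2 :> nat)]).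
      by apply: definable_B02; lia.
    by apply/setP=> j; rewrite !inE /kept (negPf even_d) i1 (_ : 2 < d) //; lia.
  + apply: (def_le (2 * d - 2 * i)) => j lt_jd.
    by rewrite (negPf even_d) (negPf ne_i1) /=; case: ifP => ?; lia.
- by apply: (def_le (2 * d - 1 - 2 * i)) => j; lia.
- have {}d_gt3 := d_gt3 erefl.
  have [odd_d|even_d] := boolP (odd d); last have [i1|ne_i1] := eqVneq i 1.
  + apply: (def_le (2 * d - 3 - 2 * i)) => j lt_jd.
    by rewrite odd_d; case: ifP => ?; [|case: ifP => ?]; lia.
  + apply: (def_le (2 * d - 4)) => j lt_jd.
    by rewrite (negPf even_d) i1 /=; case: ifP => ?; [|case: ifP => ?]; lia.
  + apply: (def_le (2 * d - 1 - 2 * i)) => j lt_jd.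
    rewrite (negPf even_d) (negPf ne_i1).
    by case: ifP => ?; [|case: ifP => ?]; lia.
Qed.

Lemma flag_card_steps T : (T = TypeD -> 3 < d) ->
  let m := series_length T d in
  let c i := flag_card T i - flag_card T i.+1 in
  [/\ forall i j, i < m -> j < m -> c i = 1 -> c j = 1 -> i = j,
      T = TypeD -> exists2 i, i < m & c i = 3 /\
        forall j, j < m -> j <> i -> c j = 1 \/ c j = 2
    & T <> TypeD -> forall i, i < m -> c i = 1 \/ c i = 2].
Proof.
rewrite /flag_card /series_length; case: T => d_gt3 /=.
- by split=> // [i j|_ i]; lia.
- case: (boolP (odd d)) => odd_d; last by split=> // [i j|_ i]; lia.
  by split=> // [i j|_ i]; do !case: ifP => ?; lia.
- by split=> // [i j|_ i]; lia.
have {}d_gt3 := d_gt3 erefl.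
case: (boolP (odd d)) => odd_d; split=> //.
- by move=> i j; do !case: ifP => ?; lia.
- move=> _; exists 0; first by lia.
  by split=> /= [|j]; do ?case: ifP => ?; lia.
- by move=> i j; do !case: ifP => ?; lia.
- move=> _; exists d./2.-1; first by lia.
  by split=> /= [|j]; do ?case: ifP => ?; lia.
Qed.

End Flag.

(** * The series *)

(** The matrices of [{'GL_N[F]}] have size [N.-1.+1], and [conform_mx] casts
    between this size and [N].  For a variable [N], which can be replaced by
    [n.+1], the cast is the identity; the size that occurs for the adjoint
    representation is a sum of two lengths. *)
Lemma generated_series (T : classical_type) (d p N : nat)
    (a : 'rV[int]_(ambient_dim T d) -> 'M[int]_N) (wt : 'I_N -> int)
    (X : 'rV[int]_(ambient_dim T d) -> 'F_p -> 'M['F_p]_N) :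
    0 < d -> (T = TypeD -> 3 < d) -> prime p -> 2 < p -> 0 < N ->
    (forall r, r \in roots T d -> a r *m (a r *m a r) = 0)%R ->
    (forall r s, r \in roots T d -> s \in roots T d -> r + s \in roots T d ->
      exists2 c : int, `|c|%N = (s - r \in roots T d).+1
                     & a r *m a s = a s *m a r + a (r + s) *~ c)%R ->
    (forall r s, r \in roots T d -> s \in roots T d -> r + s != 0 ->
      r + s \notin roots T d -> a r *m a s = a s *m a r)%R ->
    (forall r i j, r \in roots T d -> a r i j != 0 ->
      wt i = wt j + height2 r)%R ->
    (forall s, s \in pos_roots T d ->
      exists i, exists j, exists k : int,
      [/\ wt i = height2 s, wt j = 0, (0 < `|k| < 3)%N
        & {in pos_roots T d, forall r, a r i j = if r == s then k else 0}])%R ->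
    injective (fun i : 'I_d => simple_root d T i) ->
    (forall r t, r \in roots T d ->
      X r t = 1%:M + t *: map_mx intr (a r)
        + (t ^+ 2 / 2) *: (map_mx intr (a r) *m map_mx intr (a r)))%R ->
  forall U : {group {'GL_N['F_p]}},
    U :=: <<[set g : {'GL_N['F_p]} | has (fun r => [exists t : 'F_p,
             GLval g == conform_mx 0%R (X r t)]) (pos_roots T d)]>>%g ->
  let m := series_length T d in
  (p.-abelem (U / [~: U, U]))%g /\
  exists W : nat -> {group coset_of [~: U, U]},
    [/\ W 0 = (U / [~: U, U])%G, W m = 1%G,
        forall i, i < m -> W i.+1 \proper W i
      & forall i, i <= m -> Aut_invariant (W i)] /\
    (forall i, i < m ->
      factor_dim p (W i) (W i.+1) = flag_card d T i - flag_card d T i.+1).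
Proof.
move=> d_gt0 d_gt3 p_prime p_ge3; case: N a wt X => // n a wt X _.
move=> a_cube a_br a_comm a_graded a_detect al_inj DX U DU m.
have d_gt1 : T = TypeD -> 1 < d by move/d_gt3/ltnW/ltnW.
have [abelU [W [propsW dimW]]] := unipotent_series
  d_gt0 d_gt1 p_prime p_ge3 a_cube a_br a_comm a_graded a_detect al_inj (flag0
    d T) (flag_last d_gt3)
  (fun i => @flag_properS d T i d_gt3) (fun i => @flag_definable d T i d_gt3).
have {DU} -> : U = root_filtration (pos_roots T d) (@height d T)
  (@unipotent_elt T d p n a) 1.
  apply: group_inj; rewrite DU /=; congr <<_>>%g; apply/setP=> g; rewrite !inE.
  apply: eq_in_has => r pos_r; have Phi_r := pos_rootW pos_r.
  have [-> _] := pos_root_height d_gt0 d_gt1 pos_r; apply: eq_existsb => t.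
  rewrite conform_mx_id (DX r t Phi_r).
  have := val_unipotent_elt p_prime p_ge3 a_cube t Phi_r.
  rewrite unipotent_mxE => <-; exact: val_eqE.
split=> //; exists W; split=> // i lt_im.
by rewrite dimW // !card_flag // ltnW.
Qed.

Theorem corollary1p3 (T : classical_type) (d p : nat)
    (K : archiNumFieldType) (L : vectType K) (br : L -> L -> L)
    (h e : 'rV[int]_(ambient_dim T d) -> L) :
  0 < d -> (T = TypeD -> 4 <= d) ->
  prime p -> 3 <= p ->
  lie_bracket br -> chevalley_basis br h e ->
  let U := unipotent_subgroup br h e p in
  let m := series_length T d in
  (p.-abelem (U / [~: U, U]))%g /\
  exists W : nat -> {group coset_of [~: U, U]},
    let dim i := factor_dim p (W i) (W i.+1) in
    [/\ [/\ W 0 = (U / [~: U, U])%G,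
            W m = 1%G,
            forall i, i < m -> W i.+1 \proper W i
          & forall i, i <= m -> Aut_invariant (W i)],
        forall i j, i < m -> j < m -> dim i = 1 -> dim j = 1 -> i = j,
        T = TypeD -> exists2 i, i < m & dim i = 3 /\
          forall j, j < m -> j <> i -> dim j = 1 \/ dim j = 2
      & T <> TypeD -> forall i, i < m -> dim i = 1 \/ dim i = 2].
Proof.
move=> d_gt0 d_gt3 p_prime p_ge3 br_lie he_basis U m.
have d_gt1 : T = TypeD -> 1 < d by move/d_gt3/ltnW/ltnW.
have N_gt0 : 0 < size (simple_roots T d) + size (roots T d).
  by rewrite size_simple_roots // addn_gt0 d_gt0.
have Fp2 := two_Fp_neq0 p_prime p_ge3.
have [|abelU [W [propsW dimW]]] := @generated_series T d p _ (int_ad br h e)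
  (@basis_height T d) (fun r t => root_mx br h e r t)
  d_gt0 d_gt3 p_prime p_ge3 N_gt0
  (fun r => int_ad_cube d_gt0 d_gt1 br_lie he_basis (r := r))
  (fun r s => int_ad_br d_gt0 d_gt1 br_lie he_basis (r := r) (s := s))
  (fun r s => int_ad_comm d_gt0 d_gt1 br_lie he_basis (r := r) (s := s))
  (fun r i j =>
     int_ad_graded d_gt0 d_gt1 br_lie he_basis (r := r) (i := i) (j := j))
  (int_ad_detect d_gt0 d_gt1 br_lie he_basis)
  (simple_root_inj d_gt0 he_basis)
  (fun r t Phi_r => root_mxE d_gt0 d_gt1 br_lie he_basis t Phi_r Fp2) U.
  by [].
have [dim1 dim3 dim2] := flag_card_steps d_gt3.
split=> //; exists W => dim; split=> //.
- by move=> i j lt_im lt_jm; rewrite /dim !dimW //; apply: dim1.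
- move=> tD; have [i lt_im [Di Dj]] := dim3 tD.
  exists i; rewrite // /dim dimW //; split=> // j lt_jm ne_ji.
  by rewrite dimW //; apply: Dj.
- by move=> nD i lt_im; rewrite /dim dimW //; apply: dim2.
Qed.
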